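(* Consider $\min_{x\in\mathbb{R}^d} f(x)$ with $f=\frac1n\sum_{i=1}^n f_i$ and $f_i(x)=\mathbb{E}_{\xi_i\sim\mathcal{D}_i}[f_i(x;\xi_i)]$. Assume: (i) every compressor $\mathcal{C}_i^t$ is $\alpha$-contractive with a common $\alpha\in(0,1]$; (ii) $f^{\inf}:=\inf_{x\in\mathbb{R}^d} f(x)>-\infty$; (iii) for each $i$ there is $L_i>0$ with $\|\nabla f_i(x)-\nabla f_i(y)\|\le L_i\|x-y\|$ for all $x,y\in\mathbb{R}^d$; (iv) there is $L>0$ with $\|\nabla f(x)-\nabla f(y)\|\le L\|x-y\|$ for all $x,y\in\mathbb{R}^d$; (v) for each $i$ there is $L_{h,i}>0$ with $\|\nabla^2 f_i(x)-\nabla^2 f_i(y)\|\le L_{h,i}\|x-y\|$ for all $x,y\in\mathbb{R}^d$, and $L_h>0$ is a constant with $\|\nabla^2 f(x)-\nabla^2 f(y)\|\le L_h\|x-y\|$ for all $x,y\in\mathbb{R}^d$; (vi) for all $i$ and all $x\in\mathbb{R}^d$: $\mathbb{E}[\nabla f_i(x;\xi_i)]=\nabla f_i(x)$ and $\mathbb{E}\|\nabla f_i(x;\xi_i)-\nabla f_i(x)\|^2\le\sigma_g^2$, and also $\mathbb{E}[\nabla^2 f_i(x;\xi_i)]=\nabla^2 f_i(x)$ and $\mathbb{E}\|\nabla^2 f_i(x;\xi_i)-\nabla^2 f_i(x)\|^2\le\sigma_h^2$. Let $\gamma_0>0$ and $$\eta_t=\left(\frac{2}{t+2}\right)^{2/3},\qquad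 \gamma_t=\gamma_0\left(\frac{2}{t+2}\right)^{2/3}.$$ Then for every $T\ge1$ the iterates $\{x^t\}$ of the algorithm $\|\text{EF21-HM}\|$ satisfy $$\mathbb{E}\big[\|\nabla f(\tilde x^T)\|\big]=\widetilde{\mathcal{O}}\left(\frac{V_0/\gamma_0+D_\sigma\left(1/\sqrt n+1/\alpha^2\right)+\gamma_0D_1+\gamma_0^2D_2}{T^{1/3}}\right),$$ where $\tilde x^T$ is chosen at random from $\{x^0,\dots,x^{T-1}\}$, equal to $x^t$ with probability $\gamma_t/\sum_{s=0}^{T-1}\gamma_s$, $D_\sigma=\sigma_g+\gamma_0\sigma_h$, $D_1=L+\bar L/\alpha^2$, $D_2=L_h+\bar L_h/\alpha^2$, $\bar L=\frac1n\sum_{i=1}^nL_i$ and $\bar L_h=\frac1n\sum_{i=1}^nL_{h,i}$.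
   Context: $\|\cdot\|$ is the Euclidean norm for vectors and the spectral norm for matrices. A possibly randomized map $\mathcal{C}:\mathbb{R}^d\to\mathbb{R}^d$ is $\alpha$-contractive if $\mathbb{E}\|\mathcal{C}(v)-v\|^2\le(1-\alpha)\|v\|^2$ for all $v\in\mathbb{R}^d$. Algorithm $\|\text{EF21-HM}\|$. Inputs: $x^0\in\mathbb{R}^d$ and $g_i^0,v_i^0\in\mathbb{R}^d$ for $i=1,\dots,n$ (deterministic), stepsizes $\gamma_t>0$, momentum parameters $\eta_t\in(0,1]$, compressors $\mathcal{C}_i^t$. For $t=0,1,2,\dots$, with $g^t=\frac1n\sum_{i=1}^n g_i^t$: $$x^{t+1}=x^t-\gamma_t\frac{g^t}{\|g^t\|},\qquad v_i^{t+1}=(1-\eta_t)\left(v_i^t+\nabla^2f_i(x^{t+1};\xi_i^{t+1})(x^{t+1}-x^t)\right)+\eta_t\nabla f_i(x^{t+1};\xi_i^{t+1}),$$ $$g_i^{t+1}=g_i^t+\mathcal{C}_i^{t+1}(v_i^{t+1}-g_i^t).$$ If $g^t=0$, the quotient $g^t/\|g^t\|$ is read as $0$. The samples $\xi_i^{t+1}\sim\mathcal{D}_i$ are independent across clients $i$ and iterations $t$ and independent of everything generated earlier; the randomness of the compressor $\mathcal{C}_i^{t+1}$ is fresh, i.e. independent of its input and of the past. $\displaystyle V_0=f(x^0)-f^{\inf}+\frac{2\gamma_0}{1-\sqrt{1-\alpha}}\cdot\frac1n\sum_{i=1}^n\|g_i^0-v_i^0\|+\frac{2\gamma_0\sqrt{1-\alpha}}{1-\sqrt{1-\alpha}}\cdot\frac1n\sum_{i=1}^n\|v_i^0-\nabla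 f_i(x^0)\|.$ $A_T=\widetilde{\mathcal{O}}(B_T)$ means that there are universal numerical constants $C>0$, $p\ge0$ (independent of the problem, of the algorithm's inputs, and of $T$) such that $A_T\le C(1+\log(T+1))^pB_T$ for all $T\ge1$. The functions $f_i$ and $f_i(\cdot;\xi_i)$ are twice differentiable. *)

(* Defs.v *)
From HB Require Import structures.
From mathcomp Require Import all_boot all_order all_algebra.
From mathcomp Require Import all_classical all_reals all_analysis.

Set Implicit Arguments.
Unset Strict Implicit.
Unset Printing Implicit Defensive.

Import Order.TTheory GRing.Theory Num.Theory.
Import numFieldNormedType.Exports.

Local Open Scope classical_set_scope.
Local Open Scope ring_scope.

(* Vectors of R^d are row vectors. The library norm on matrices is the sup
   norm; it induces the same topology as the Euclidean norm, so the library's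
   differentiability and Borel sets are the usual ones. *)

Definition enorm (R : realType) (d : nat) (u : 'rV[R]_d) : R :=
  Num.sqrt (\sum_(i < d) u 0 i ^+ 2).

Definition spectral_norm (R : realType) (d : nat) (A : 'M[R]_d) : R :=
  sup [set enorm (u *m A) | u in [set u : 'rV[R]_d | enorm u <= 1]].

Definition grad (R : realType) (d : nat) (f : 'rV[R]_d -> R) (x : 'rV[R]_d) :
    'rV[R]_d :=
  \row_(i < d) 'D_(delta_mx 0 i) f x.

(* [u *m hess f x] is the derivative of [grad f] at [x] in the direction [u]:
   in row notation, the Hessian of [f] at [x] applied to [u]. *)
Definition hess (R : realType) (d : nat) (f : 'rV[R]_d -> R) (x : 'rV[R]_d) :
    'M[R]_d :=
  'J (grad f) x.

Definition twice_differentiable (R : realType) (d : nat)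
    (f : 'rV[R]_d -> R) : Prop :=
  (forall x, differentiable f x) /\ (forall x, differentiable (grad f) x).

Definition lipschitz_grad (R : realType) (d : nat) (L : R)
    (f : 'rV[R]_d -> R) : Prop :=
  forall x y, enorm (grad f x - grad f y) <= L * enorm (x - y).

Definition lipschitz_hess (R : realType) (d : nat) (L : R)
    (f : 'rV[R]_d -> R) : Prop :=
  forall x y, spectral_norm (hess f x - hess f y) <= L * enorm (x - y).

Definition average (R : realType) (V : lmodType R) (n : nat)
    (u : 'I_n -> V) : V :=
  n%:R^-1 *: \sum_(i < n) u i.

Definition raverage (R : realType) (n : nat) (a : 'I_n -> R) : R :=
  n%:R^-1 * \sum_(i < n) a i.

Definition has_mean (R : realType) (dX : measure_display)
    (X : measurableType dX) (D : probability X R) (Y : X -> R) (m : R) : Prop :=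
  D.-integrable setT (EFin \o Y) /\ ('E_D[Y] = m%:E)%E.

Definition has_mean_mx (R : realType) (dX : measure_display)
    (X : measurableType dX) (D : probability X R) (m k : nat)
    (Y : X -> 'M[R]_(m, k)) (M : 'M[R]_(m, k)) : Prop :=
  forall i j, has_mean D (fun s => Y s i j) (M i j).

Definition borel_rV (R : realType) (d : nat) :=
  g_sigma_algebraType (@open 'rV[R]_d).

Definition sigma_of (T : Type) (dY : measure_display) (Y : measurableType dY)
    (X : T -> Y) : set (set T) :=
  preimage_set_system setT X measurable.

Definition independent (R : realType) (dO : measure_display)
    (Omega : measurableType dO) (P : probability Omega R)
    (G H : set (set Omega)) : Prop :=
  forall A B, G A -> H B -> (P (A `&` B) = P A * P B)%E.

Definition mutually_independent (R : realType) (dO : measure_display)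
    (Omega : measurableType dO) (P : probability Omega R) (I : finType)
    (G : I -> set (set Omega)) : Prop :=
  forall (J : {set I}) (A : I -> set Omega), (forall i, i \in J -> G i (A i)) ->
    (P (\big[setI/setT]_(i in J) A i) = \prod_(i in J) P (A i))%E.

(* A random map of R^d is given jointly measurably by a deterministic map [c]
   with a seed argument and a random seed [Z]. *)
Definition random_map_measurable (R : realType) (d : nat)
    (dS : measure_display) (S : measurableType dS)
    (c : S -> 'rV[R]_d -> 'rV[R]_d) : Prop :=
  measurable_fun [set: S * borel_rV R d]
    (fun p : S * borel_rV R d => c p.1 p.2 : borel_rV R d).

Definition contractive (R : realType) (dO : measure_display)
    (Omega : measurableType dO) (P : probability Omega R) (d : nat) (alpha : R)
    (c : Omega -> 'rV[R]_d -> 'rV[R]_d) : Prop :=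
  forall v : 'rV[R]_d,
    ('E_P[fun w => (enorm (c w v - v) ^+ 2)%R]
       <= ((1 - alpha) * enorm v ^+ 2)%:E)%E.

Record ef21_state (R : realType) (n d : nat) := EF21State {
  st_x : 'rV[R]_d;
  st_g : 'I_n -> 'rV[R]_d;
  st_v : 'I_n -> 'rV[R]_d }.

Section EF21_HM.
Variables (R : realType) (n d : nat) (gamma eta : nat -> R).

(* [(enorm u)^-1 *: u] is 0 when [u = 0]. *)
Definition ef21_step_x (t : nat) (s : ef21_state R n d) : 'rV[R]_d :=
  let gbar := average (st_g s) in
  st_x s - gamma t *: ((enorm gbar)^-1 *: gbar).

(* [phi i] is the sampled function f_i(.; xi_i^{t+1}). *)
Definition ef21_step_v (phi : 'I_n -> 'rV[R]_d -> R) (t : nat)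
    (s : ef21_state R n d) (i : 'I_n) : 'rV[R]_d :=
  let x' := ef21_step_x t s in
  (1 - eta t) *: (st_v s i + (x' - st_x s) *m hess (phi i) x')
    + eta t *: grad (phi i) x'.

Definition ef21_step (phi : 'I_n -> 'rV[R]_d -> R)
    (c : 'I_n -> 'rV[R]_d -> 'rV[R]_d) (t : nat) (s : ef21_state R n d) :
    ef21_state R n d :=
  EF21State (ef21_step_x t s)
    (fun i => st_g s i + c i (ef21_step_v phi t s i - st_g s i))
    (ef21_step_v phi t s).

(* [phi t i] is f_i(.; xi_i^t) and [c t i] is the realization of C_i^t; only
   the indices t >= 1 are used. *)
Fixpoint ef21_hm (x0 : 'rV[R]_d) (g0 v0 : 'I_n -> 'rV[R]_d)
    (phi : nat -> 'I_n -> 'rV[R]_d -> R)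
    (c : nat -> 'I_n -> 'rV[R]_d -> 'rV[R]_d) (t : nat) : ef21_state R n d :=
  if t is t'.+1 then
    ef21_step (phi t) (c t) t' (ef21_hm x0 g0 v0 phi c t')
  else EF21State x0 g0 v0.

End EF21_HM.

(* sigma(xi_i^s, zeta_i^s : 1 <= s <= t, i < n) *)
Definition history (R : realType) (dO : measure_display)
    (Omega : measurableType dO) (P : probability Omega R) (n : nat)
    (dX : 'I_n -> measure_display) (X : forall i, measurableType (dX i))
    (dZ : nat -> 'I_n -> measure_display)
    (Z : forall t i, measurableType (dZ t i))
    (xi : forall (t : nat) (i : 'I_n), {RV P >-> X i})
    (zeta : forall (t : nat) (i : 'I_n), {RV P >-> Z t i})
    (t : nat) : set (set Omega) :=
  <<s \bigcup_(s in [set s | (1 <= s <= t)%N]) \bigcup_(i in [set: 'I_n])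
        (sigma_of (xi s i) `|` sigma_of (zeta s i)) >>.

Definition decay (R : realType) (t : nat) : R := (2 / t.+2%:R) `^ (2 / 3).

Definition V0 (R : realType) (n d : nat) (alpha gamma0 : R)
    (f : 'I_n -> 'rV[R]_d -> R) (x0 : 'rV[R]_d)
    (g0 v0 : 'I_n -> 'rV[R]_d) : R :=
  let F x := raverage (fun i => f i x) in
  let r := Num.sqrt (1 - alpha) in
  F x0 - inf (range F)
  + 2 * gamma0 / (1 - r) * raverage (fun i => enorm (g0 i - v0 i))
  + 2 * gamma0 * r / (1 - r)
    * raverage (fun i => enorm (v0 i - grad (f i) x0)).

(* Main.v *)
(* Write e_i = v_i - grad f_i(x). The momentum recursion turns e_i into a
   deterministically bounded part, fed by Taylor remainders of size
   L_{h,i} gamma_t^2 / 2, plus a discounted sum W_i of martingale increments M_i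
   with E |M_i|^2 <= 2 eta_t^2 D_sigma^2. Hence E |W_i|^2 is of order
   eta_t D_sigma^2, and independence of the clients divides it by n for the
   average of the W_i. The compression error |g_i - v_i| contracts by
   sqrt(1 - alpha) at each step, up to the increment of v_i, which is of order
   eta_t. The normalized step gives
     F(x^{t+1}) + gamma_t |grad F(x^t)|
       <= F(x^t) + 2 gamma_t |grad F(x^t) - g^t| + L gamma_t^2 / 2,
   which is summed over t. The exponents 2/3 make eta_t^2 and eta_t^{3/2} at most
   2 / (t + 2), so all error sums are of order log T, while the sum of the
   gamma_t is at least gamma0 T^{1/3}. *)
Require Import Defs.
From HB Require Import structures.
From mathcomp Require Import all_boot all_order all_algebra.
From mathcomp Require Import all_classical all_reals all_analysis.
From mathcomp Require Import measurable_realfun.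
From mathcomp Require Import ring lra.
Import Order.TTheory GRing.Theory Num.Theory.
Import numFieldNormedType.Exports.
Local Open Scope classical_set_scope.
Local Open Scope ring_scope.
Set Implicit Arguments.
Unset Strict Implicit.
Unset Printing Implicit Defensive.

(** * Euclidean norm and Taylor bounds *)

(** No conditional expectation occurs. Each fresh sample or compressor seed is independent of a
    sigma-algebra that determines the point at which it is used, so Tonelli's theorem lets that
    point be frozen at every outcome and a hypothesis stated for fixed points be applied
    ([expectation_freeze_le]). The price is joint measurability in sample and point. It comes from
    smoothness: gradients are continuous in the point, and Hessian entries are limits of difference
    quotients of gradients.

    Descent is summed on each path before any expectation is taken, and only nonnegative quantities
    are then averaged, so no integrability of the trajectory has to be shown.

    The delicate quantity is the error of [v0]: its coefficient in [V0] carries the factor sqrt(1 -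
    alpha), which may vanish. Since [decay R 0 = 1], the first step replaces [v0] entirely. Its
    error therefore survives in two places only: in the first compression, which supplies the factor
    sqrt(1 - alpha), and in the direction of the very first step, which is treated apart. *)

Definition dot (R : realType) (d : nat) (u v : 'rV[R]_d) : R :=
  \sum_(i < d) u 0 i * v 0 i.

Section EuclideanNorm.
Context {R : realType}.

Section FixedDimension.
Context {d : nat}.
Implicit Types (u v w : 'rV[R]_d) (k : R).

Lemma dotC u v : dot u v = dot v u.
Proof. by apply: eq_bigr => i _; rewrite mulrC. Qed.

Lemma dotDl u v w : dot (u + v) w = dot u w + dot v w.
Proof. by rewrite -big_split; apply: eq_bigr => i _; rewrite mxE mulrDl. Qed.

Lemma dotDr u v w : dot w (u + v) = dot w u + dot w v.
Proof. by rewrite dotC dotDl !(dotC w). Qed.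

Lemma dotZl k u v : dot (k *: u) v = k * dot u v.
Proof. by rewrite /dot mulr_sumr; apply: eq_bigr => i _; rewrite mxE mulrA. Qed.

Lemma dotZr k u v : dot u (k *: v) = k * dot u v.
Proof. by rewrite dotC dotZl dotC. Qed.

Lemma dotNl u v : dot (- u) v = - dot u v.
Proof. by rewrite -scaleN1r dotZl mulN1r. Qed.

Lemma dotNr u v : dot u (- v) = - dot u v.
Proof. by rewrite dotC dotNl dotC. Qed.

Lemma enorm_ge0 u : 0 <= enorm u.
Proof. exact: sqrtr_ge0. Qed.

Lemma enorm_sqr u : enorm u ^+ 2 = dot u u.
Proof.
rewrite sqr_sqrtr; last by apply: sumr_ge0 => i _; apply: sqr_ge0.
by apply: eq_bigr => i _; rewrite expr2.
Qed.

Lemma enormZ k u : enorm (k *: u) = `|k| * enorm u.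
Proof.
apply: (@pexpIrn _ 2) => //; rewrite ?nnegrE ?mulr_ge0 ?enorm_ge0 //.
by rewrite exprMn !enorm_sqr dotZl dotZr mulrA -expr2 real_normK ?num_real.
Qed.

Lemma enormN u : enorm (- u) = enorm u.
Proof. by rewrite -scaleN1r enormZ normrN1 mul1r. Qed.

Lemma enorm0 : enorm (0 : 'rV[R]_d) = 0.
Proof. by rewrite -(scale0r 0) enormZ normr0 mul0r. Qed.

Lemma enorm_distC u v : enorm (u - v) = enorm (v - u).
Proof. by rewrite -enormN opprB. Qed.

Lemma normr_coord_le_enorm u i : `|u 0 i| <= enorm u.
Proof.
rewrite -sqrtr_sqr ler_sqrt (bigD1 i) //=.
  by rewrite lerDl sumr_ge0 // => j _; apply: sqr_ge0.
by rewrite addr_ge0 ?sqr_ge0 ?sumr_ge0 // => j _; apply: sqr_ge0.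
Qed.

Lemma enorm_eq0 u : enorm u = 0 -> u = 0.
Proof.
move=> u0; apply/rowP => i; rewrite mxE; apply/eqP; rewrite -normr_le0.
by rewrite -u0 normr_coord_le_enorm.
Qed.

(** Cauchy-Schwarz: the squared norm of [enorm v ^+ 2 *: u - dot u v *: v] equals |v|^2 (|u|^2 |v|^2
    - (u.v)^2). *)
Lemma dot_le_enorm u v : dot u v <= enorm u * enorm v.
Proof.
have [v0|v0] := eqVneq (enorm v) 0.
  by rewrite v0 mulr0 (enorm_eq0 v0) -(scale0r 0) dotZr mul0r.
have vgt0 : 0 < enorm v by rewrite lt_neqAle eq_sym v0 enorm_ge0.
apply: le_trans (ler_norm _) _.
rewrite -(ler_pXn2r (n := 2)) ?nnegrE ?mulr_ge0 ?enorm_ge0 //.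
rewrite real_normK ?num_real // exprMn.
have := sqr_ge0 (enorm (enorm v ^+ 2 *: u - dot u v *: v)).
rewrite [enorm (_ - _) ^+ 2]enorm_sqr dotDl !dotDr !dotNl !dotNr !dotZl !dotZr.
rewrite -!enorm_sqr (dotC v u).
set a := enorm u; set b := enorm v in vgt0 *; set c := dot u v => H.
have : 0 <= b ^+ 2 * (a ^+ 2 * b ^+ 2 - c ^+ 2) by move: H; lra.
by rewrite pmulr_rge0 ?exprn_gt0 // subr_ge0.
Qed.

Lemma ler_enormD u v : enorm (u + v) <= enorm u + enorm v.
Proof.
rewrite -(ler_pXn2r (n := 2)) ?nnegrE ?addr_ge0 ?enorm_ge0 //.
rewrite enorm_sqr dotDl !dotDr -!enorm_sqr (dotC v u).
have := dot_le_enorm u v; lra.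
Qed.

Lemma enorm_normalize_le1 u : enorm ((enorm u)^-1 *: u) <= 1.
Proof.
rewrite enormZ ger0_norm ?invr_ge0 ?enorm_ge0 //.
by have [->|u0] := eqVneq (enorm u) 0; rewrite ?mulr0 ?mulVf.
Qed.

Lemma dot_normalize u : dot u ((enorm u)^-1 *: u) = enorm u.
Proof.
rewrite dotZr -enorm_sqr.
by have [->|u0] := eqVneq (enorm u) 0; rewrite expr2 ?mulr0 ?mulKf.
Qed.

Lemma ler_enormB u v : enorm (u - v) <= enorm u + enorm v.
Proof. by rewrite -(enormN v) ler_enormD. Qed.

Lemma enorm_sqrD_le u v :
  enorm (u + v) ^+ 2 <= 2 * enorm u ^+ 2 + 2 * enorm v ^+ 2.
Proof.
apply: (@le_trans _ _ ((enorm u + enorm v) ^+ 2)).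
  by rewrite ler_pXn2r ?nnegrE ?addr_ge0 ?enorm_ge0 ?ler_enormD.
have := sqr_ge0 (enorm u - enorm v); lra.
Qed.

Lemma ler_enorm_sum (I : Type) (s : seq I) (u : I -> 'rV[R]_d) :
  enorm (\sum_(i <- s) u i) <= \sum_(i <- s) enorm (u i).
Proof.
elim: s => [|i s IH]; first by rewrite !big_nil enorm0.
by rewrite !big_cons; apply: le_trans (ler_enormD _ _) _; rewrite lerD2l.
Qed.

Lemma ler_enorm_average n (u : 'I_n -> 'rV[R]_d) :
  enorm (average u) <= raverage (fun i => enorm (u i)).
Proof.
rewrite enormZ ger0_norm ?invr_ge0 // ler_wpM2l ?invr_ge0 //.
exact: ler_enorm_sum.
Qed.

End FixedDimension.

Lemma mulmx_row_sum (d k : nat) (u : 'rV[R]_d) (A : 'M[R]_(d, k)) :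
  u *m A = \sum_(i < d) u 0 i *: row i A.
Proof.
apply/rowP => j; rewrite mxE summxE; apply: eq_bigr => i _.
by rewrite !mxE.
Qed.

Lemma spectral_norm_ub (d : nat) (A : 'M[R]_d) (u : 'rV[R]_d) :
  enorm u <= 1 -> enorm (u *m A) <= spectral_norm A.
Proof.
move=> u1; apply: sup_ubound; last by exists u.
(* [sup] is meaningful only for a bounded set. The row norms bound it because every coordinate of a
   vector in the unit ball is at most 1 in absolute value. *)
exists (\sum_(i < d) enorm (row i A)) => _ [v /= v1 <-].
rewrite mulmx_row_sum; apply: le_trans (ler_enorm_sum _ _) _.
apply: ler_sum => i _; rewrite enormZ ler_piMl ?enorm_ge0 //.
exact: le_trans (normr_coord_le_enorm _ _) v1.
Qed.

Lemma spectral_norm_ge0 (d : nat) (A : 'M[R]_d) : 0 <= spectral_norm A.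
Proof.
have := @spectral_norm_ub d A 0.
by rewrite mul0mx !enorm0; apply.
Qed.

Lemma enorm_mulmx_le (d : nat) (u : 'rV[R]_d) (A : 'M[R]_d) :
  enorm (u *m A) <= spectral_norm A * enorm u.
Proof.
have [u0|u0] := eqVneq (enorm u) 0.
  by rewrite (enorm_eq0 u0) mul0mx enorm0 mulr0.
have ugt0 : 0 < enorm u by rewrite lt_neqAle eq_sym u0 enorm_ge0.
rewrite -ler_pdivrMr // mulrC -[(enorm u)^-1]ger0_norm ?invr_ge0 ?enorm_ge0 //.
rewrite -enormZ scalemxAl; apply: spectral_norm_ub.
exact: enorm_normalize_le1.
Qed.

End EuclideanNorm.

(** * Derivatives along lines and second-order bounds *)

Section SmoothFunctions.
Context {R : realType}.

(** The mean value theorem for [h], which is [phi] minus its linear part at 0 and the parabola with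
    second derivative [K]; the derivative of [h] is nonpositive on [0, 1]. This takes the place of
    an integral remainder. *)
Lemma taylor1_le (phi dphi : R -> R) (K : R) :
  (forall s : R, is_derive s 1 phi (dphi s)) ->
  (forall s : R, 0 <= s <= 1 -> dphi s - dphi 0 <= K * s) ->
  phi 1 - phi 0 - dphi 0 <= K / 2.
Proof.
move=> dphiP dphi_le.
pose h s := phi s - s * dphi 0 - K / 2 * s ^+ 2.
have dh (s : R) : is_derive s 1 h (dphi s - dphi 0 - K * s).
  have := dphiP s => ?.
  apply: is_derive_eq.
  transitivity (dphi s - (s * 0 + dphi 0 * 1) - K / 2 * (s * 1 + s * 1)) => //.
  by lra.
have hc : {within `[0, 1], continuous h}.
  apply: derivable_within_continuous => s _.
  by have [] := dh s.
have [c c01 hE] := MVT_segment ler01 (fun s _ => dh s) hc.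
have := dphi_le c; move: c01; rewrite in_itv /= => /[swap] /[apply] dc.
move: hE; rewrite subr0 mulr1 /h !expr2 !mul0r !mulr0 !mulr1 !mul1r; lra.
Qed.

Section Along.
Context {d : nat}.
Implicit Types (f : 'rV[R]_d -> R) (x y u w : 'rV[R]_d).

Lemma is_derive_line f x u (s l : R) :
  is_derive (x + s *: u) u f l -> is_derive s 1 (fun s => f (x + s *: u)) l.
Proof.
have E : (fun h : R => h^-1 *: (f (x + (h *: 1 + s) *: u) - f (x + s *: u)))
  = (fun h : R => h^-1 *: (f (h *: u + (x + s *: u)) - f (x + s *: u))).
  by apply/funext => h; rewrite scalerDl addrCA -[h *: 1]/(h * 1) mulr1.
move=> [fd fE]; split.
  by move: fd; rewrite /derivable /= -E.
by rewrite -fE /derive /= -E.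
Qed.

Lemma derive_grad f x u : differentiable f x -> 'D_u f x = dot (grad f x) u.
Proof.
move=> df; rewrite deriveE // {1}[u]row_sum_delta linear_sum /=.
by apply: eq_bigr => i _; rewrite linearZ /= mxE deriveE // mulrC.
Qed.

Lemma is_derive_grad_line f x u (s : R) : (forall y, differentiable f y) ->
  is_derive s 1 (fun s => f (x + s *: u)) (dot (grad f (x + s *: u)) u).
Proof.
move=> df; apply: is_derive_line; rewrite -derive_grad //.
exact/derivableP/diff_derivable.
Qed.

Lemma derive_grad_hess f x u i :
  differentiable (grad f) x ->
  is_derive x u (fun y => grad f y 0 i) ((u *m hess f x) 0 i).
Proof.
move=> dg; have dgu : derivable (grad f) x u by exact: diff_derivable.
rewrite -deriveEjacobian // derive_mx // mxE; apply: derivableP.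
by move/derivable_mxP : dgu; apply.
Qed.

Lemma is_derive_hess_line f x u w (s : R) : (forall y, differentiable (grad f) y) ->
  is_derive s 1 (fun s => dot (grad f (x + s *: u)) w)
    (dot (u *m hess f (x + s *: u)) w).
Proof.
move=> df.
have -> : (fun s => dot (grad f (x + s *: u)) w)
    = \sum_i (w 0 i *: (fun s : R => grad f (x + s *: u) 0 i)).
  apply/funext => r; rewrite fct_sumE; apply: eq_bigr => i _.
  by rewrite mulrC.
have -> : dot (u *m hess f (x + s *: u)) w
    = \sum_i (w 0 i *: (u *m hess f (x + s *: u)) 0 i).
  by apply: eq_bigr => i _; rewrite mulrC.
apply: is_derive_sum => i; apply: is_deriveZ.
exact/(@is_derive_line (fun y => grad f y 0 i))/derive_grad_hess.
Qed.

Lemma lipschitz_grad_descent f L x u :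
  (forall y, differentiable f y) -> lipschitz_grad L f ->
  f (x + u) <= f x + dot (grad f x) u + L / 2 * enorm u ^+ 2.
Proof.
move=> df lf.
have := @taylor1_le _ _ (L * enorm u ^+ 2)
  (fun s => is_derive_grad_line x u s df).
rewrite /= scale1r scale0r addr0 => H; suff : f (x + u) - f x
  - dot (grad f x) u <= L * enorm u ^+ 2 / 2 by lra.
apply: H => s /andP[s0 _]; rewrite -dotNl -dotDl.
apply: le_trans (dot_le_enorm _ _) _.
apply: le_trans (ler_wpM2r (enorm_ge0 _) (lf _ _)) _.
rewrite addrAC subrr add0r enormZ ger0_norm //.
by rewrite expr2 -!mulrA (mulrC s) !mulrA.
Qed.

(** The remainder [e] is paired with itself: [taylor1_le] applies to the scalar function s |-> grad
    f (x + s u) . e and bounds |e|^2 by a multiple of |e|, which is then cancelled. *)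
Lemma lipschitz_hess_taylor f Lh x u : 0 <= Lh ->
  (forall y, differentiable (grad f) y) -> lipschitz_hess Lh f ->
  enorm (grad f (x + u) - grad f x - u *m hess f x) <= Lh / 2 * enorm u ^+ 2.
Proof.
move=> Lh0 df lf; set e := (X in enorm X).
have := @taylor1_le _ _ (Lh * enorm u ^+ 2 * enorm e)
  (fun s => is_derive_hess_line x u e s df).
rewrite /= scale1r scale0r addr0 -!dotNl -!dotDl -/e -enorm_sqr => H.
have {H} : enorm e ^+ 2 <= Lh * enorm u ^+ 2 * enorm e / 2.
  apply: H => s /andP[s0 _]; rewrite -dotDl -mulmxBr.
  apply: le_trans (dot_le_enorm _ _) _.
  rewrite [leRHS]mulrAC; apply: ler_wpM2r; first exact: enorm_ge0.
  apply: le_trans (enorm_mulmx_le _ _) _.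
  apply: le_trans (ler_wpM2r (enorm_ge0 _) (lf _ _)) _.
  rewrite addrAC subrr add0r enormZ ger0_norm //.
  by rewrite expr2 -!mulrA (mulrC s) !mulrA.
have [->|e0] := eqVneq (enorm e) 0.
  by rewrite mulr_ge0 ?sqr_ge0 // divr_ge0.
have egt0 : 0 < enorm e by rewrite lt_neqAle eq_sym e0 enorm_ge0.
rewrite expr2 [leRHS]mulrAC ler_pM2r // => ?; lra.
Qed.

End Along.
End SmoothFunctions.

(** * Expectation and independence *)

Section Expectation.
Context {R : realType} {dT : measure_display} {T : measurableType dT}.
Variable P : probability T R.
Implicit Types (f g : T -> R).

(** Both integrals are suprema over simple functions below the integrand, so the comparison holds
    for arbitrary functions. It is later applied to the spectral norm of a random Hessian, which is
    not shown to be measurable. *)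
Lemma ge0_le_expectation f g : (forall w, 0 <= f w) ->
  (forall w, f w <= g w) -> ('E_P[f] <= 'E_P[g])%E.
Proof.
move=> f0 fg; have g0 w : 0 <= g w by apply: le_trans (fg w).
rewrite unlock !ge0_integralTE; [|by move=> w; rewrite lee_fin..].
apply: le_ereal_sup => _ [h hf <-]; exists h => // w.
by apply: le_trans (hf w) _; rewrite lee_fin.
Qed.

Lemma ge0_expectationD f g : (forall w, 0 <= f w) -> (forall w, 0 <= g w) ->
  measurable_fun setT f -> measurable_fun setT g ->
  ('E_P[fun w => (f w + g w)%R] = 'E_P[f] + 'E_P[g])%E.
Proof.
move=> f0 g0 mf mg; rewrite unlock; under eq_integral do rewrite EFinD.
rewrite ge0_integralD //; try by move=> w _; rewrite lee_fin.
  exact/measurable_EFinP.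
exact/measurable_EFinP.
Qed.

Lemma ge0_expectationZ k f : 0 <= k -> (forall w, 0 <= f w) ->
  measurable_fun setT f ->
  ('E_P[fun w => (k * f w)%R] = k%:E * 'E_P[f])%E.
Proof.
move=> k0 f0 mf; rewrite unlock; under eq_integral do rewrite EFinM.
rewrite ge0_integralZl_EFin //; first by move=> w _; rewrite lee_fin.
exact/measurable_EFinP.
Qed.

Lemma expectation_const (k : R) : ('E_P[fun=> k] = k%:E)%E.
Proof. exact: expectation_cst. Qed.

(* From [2 b f <= f ^+ 2 + b ^+ 2] when [b > 0]. *)
Lemma expectation_le_of_sqr f (b : R) : 0 <= b -> (forall w, 0 <= f w) ->
  measurable_fun setT f ->
  ('E_P[fun w => (f w ^+ 2)%R] <= (b ^+ 2)%:E)%E -> ('E_P[f] <= b%:E)%E.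
Proof.
move=> b0 f0 mf fb.
have pos (c : R) : 0 < c -> b <= c -> ('E_P[f] <= c%:E)%E.
  move=> c0 bc.
  apply: (@le_trans _ _
    ('E_P[fun w => ((2 * c)^-1 * f w ^+ 2 + c / 2)%R])%E).
    apply: ge0_le_expectation => // w; rewrite -subr_ge0.
    have -> : (2 * c)^-1 * f w ^+ 2 + c / 2 - f w = (2 * c)^-1 * (f w - c) ^+ 2.
      by field; rewrite gt_eqF.
    by rewrite mulr_ge0 ?sqr_ge0 ?invr_ge0 ?mulr_ge0 // ltW.
  have c20 : 0 <= (2 * c)^-1 by rewrite invr_ge0 mulr_ge0 // ltW.
  have mf2 : measurable_fun setT (fun w => f w ^+ 2) by exact: measurable_funX.
  rewrite ge0_expectationD //; first last.
  - exact: measurable_funM.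
  - by move=> w; rewrite divr_ge0 // ltW.
  - by move=> w; rewrite mulr_ge0 ?sqr_ge0.
  rewrite expectation_const ge0_expectationZ //; last first.
    by move=> w; apply: sqr_ge0.
  have : ((2 * c)^-1%:E * 'E_P[fun w => (f w ^+ 2)%R] <= (2 * c)^-1%:E * (c ^+ 2)%:E)%E.
    rewrite lee_pmul2l ?lte_fin ?invr_gt0 ?mulr_gt0 //.
    by apply: le_trans fb _; rewrite lee_fin ler_pXn2r ?nnegrE // ltW.
  rewrite -EFinM => h; apply: le_trans (leeD2r _ h) _.
  rewrite -EFinD lee_fin le_eqVlt; apply/orP; left; apply/eqP.
  by field; rewrite gt_eqF.
have [bE|bn0] := eqVneq b 0; last first.
  by apply: pos => //; rewrite lt_neqAle eq_sym bn0.
apply/lee_addgt0Pr => e e0; rewrite bE add0e.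
by apply: pos => //; rewrite bE ltW.
Qed.

(** Carries the side conditions under which integrals of nonnegative functions add, so that bounds
    on means compose like ordinary inequalities. *)
Definition mean_le f (a : R) :=
  [/\ measurable_fun setT f, forall w, 0 <= f w & ('E_P[f] <= a%:E)%E].

Lemma mean_le_cst k : 0 <= k -> mean_le (fun=> k) k.
Proof. by move=> k0; split => //; rewrite expectation_const. Qed.

Lemma mean_leD f g a b : mean_le f a -> mean_le g b ->
  mean_le (fun w => f w + g w) (a + b).
Proof.
move=> [mf f0 fa] [mg g0 gb]; split; first exact: measurable_funD.
  by move=> w; rewrite addr_ge0.
by rewrite ge0_expectationD // EFinD leeD.
Qed.

Lemma mean_leZ k f a : 0 <= k -> mean_le f a ->
  mean_le (fun w => k * f w) (k * a).
Proof.
move=> k0 [mf f0 fa]; split; first exact: measurable_funM.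
  by move=> w; rewrite mulr_ge0.
by rewrite ge0_expectationZ // EFinM lee_wpmul2l // lee_fin.
Qed.

Lemma mean_le_sum (I : Type) (s : seq I) (f : I -> T -> R) (a : I -> R) :
  (forall i, mean_le (f i) (a i)) ->
  mean_le (fun w => \sum_(i <- s) f i w) (\sum_(i <- s) a i).
Proof.
move=> H; elim: s => [|i s IH].
  by under eq_fun do rewrite big_nil; rewrite big_nil; exact: mean_le_cst.
by under eq_fun do rewrite big_cons; rewrite big_cons; exact: mean_leD.
Qed.

End Expectation.

(** * Integrating out an independent sample *)

Section Freezing.
Context {R : realType} {dO dX : measure_display} {Omega : measurableType dO}.
Context {X : measurableType dX}.
Variables (P : probability Omega R) (D : probability X R).
Variables (xi : {RV P >-> X}) (G : set (set Omega)).
Hypothesis xiD : forall A, measurable A -> distribution P xi A = D A.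
Hypothesis GP : <<s G >> `<=` (@measurable _ Omega).
Hypothesis indep : independent P (sigma_of xi) <<s G >>.

Local Notation OmegaG := (g_sigma_algebraType G).

(** The identity, seen as a random variable with values in the coarser space; its law is the
    restriction of [P] to [<<s G>>]. *)
Let forget (w : Omega) : OmegaG := w.

Let measurable_forget : measurable_fun setT forget.
Proof. by move=> _ A mA; rewrite setTI; apply: GP. Qed.

HB.instance Definition _ := isMeasurableFun.Build _ _ _ _ forget measurable_forget.

Let joint (w : Omega) : X * OmegaG := (xi w, forget w).

Let measurable_joint : measurable_fun setT joint.
Proof. exact: measurable_fun_pair. Qed.

HB.instance Definition _ := isMeasurableFun.Build _ _ _ _ joint measurable_joint.

Let PG : probability OmegaG R := distribution P forget.

(* Under [w |-> (xi w, w)], the image of [P] on [X * (Omega, <<s G>>)] is the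
   product of [D] and the restriction of [P]; the rest is Tonelli's theorem. *)
Lemma expectation_freeze (h : X -> Omega -> R) :
  (forall s w, 0 <= h s w) ->
  measurable_fun setT (fun p : X * OmegaG => h p.1 p.2) ->
  ('E_P[fun w => h (xi w) w] = \int[P]_w 'E_D[h ^~ w])%E.
Proof.
move=> h0 mh.
have mhE : measurable_fun [set: X * OmegaG] (fun p => (h p.1 p.2)%:E).
  exact/measurable_EFinP.
have prodE : {in measurable, (distribution P joint : set (X * OmegaG) -> _) =1 (D \x PG)%E}.
  move=> A /[!inE] mA; apply/esym; apply: product_measure_unique => // B C mB mC.
  transitivity (P ((xi @^-1` B) `&` C)) => //.
  transitivity (P (xi @^-1` B) * P C)%E.
    by apply: indep => //; exists B => //; rewrite setTI.
  exact: (congr1 (fun z => (z * P C)%E) (xiD mB)).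
rewrite unlock.
transitivity (\int[distribution P joint]_p (h p.1 p.2)%:E)%E.
  by rewrite ge0_integral_distribution // => p; rewrite lee_fin.
rewrite (eq_measure_integral (D \x PG)%E); last first.
  by move=> A mA _; apply: prodE; rewrite inE.
rewrite fubini_tonelli2 //; last by move=> p; rewrite lee_fin.
have := measurable_fun_fubini_tonelli_G (m1 := D) _ mhE
  (fun p => h0 _ _).
set F := fubini_G _ _ => mF.
rewrite (@ge0_integral_distribution _ _ _ _ _ P forget) //.
move=> y; apply: integral_ge0 => x _; by rewrite lee_fin.
Qed.

(** Plays the part of the tower property: [w] is fixed, the sample is averaged out, and the
    resulting bound is averaged over [w]. *)
Lemma expectation_freeze_le (h : X -> Omega -> R) (b : Omega -> R) :
  (forall s w, 0 <= h s w) ->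
  measurable_fun setT (fun p : X * OmegaG => h p.1 p.2) ->
  (forall w, 'E_D[h ^~ w] <= (b w)%:E)%E ->
  ('E_P[fun w => h (xi w) w] <= 'E_P[b])%E.
Proof.
move=> h0 mh hb; rewrite expectation_freeze //.
have h0' w : (0 <= 'E_D[h ^~ w])%E by apply: expectation_ge0.
have b0 w : (0 <= (b w)%:E)%E by exact: le_trans (h0' w) (hb w).
rewrite unlock in hb h0' *.
rewrite !ge0_integralTE //.
apply: le_ereal_sup => _ [k hf <-]; exists k => // w.
by apply: le_trans (hf w) _; exact: hb.
Qed.

End Freezing.

(** * Measurability of random vectors *)

Section VectorMeasurability.
Context {R : realType} {d : nat}.

(** Rounding down to the grid of mesh 1/(k+1). Integer vectors are countable, so events about [y]
    split into countably many cells, each given by conditions on coordinates. *)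
Definition grid_floor (k : nat) (y : 'rV[R]_d) : 'rV[int]_d :=
  \row_j Num.floor (k.+1%:R * y 0 j).

Definition grid_point (k : nat) (q : 'rV[int]_d) : 'rV[R]_d :=
  \row_j ((q 0 j)%:~R / k.+1%:R).

Lemma grid_point_floor_near k (y : 'rV[R]_d) j :
  `|y 0 j - grid_point k (grid_floor k y) 0 j| < k.+1%:R^-1.
Proof.
rewrite !mxE; set a := y 0 j; set K : R := k.+1%:R; have K0 : 0 < K by [].
have /andP[/= l u] := floor_itv (K * a).
have -> : a - (Num.floor (K * a))%:~R / K = (K * a - (Num.floor (K * a))%:~R) / K.
  by field; rewrite gt_eqF.
rewrite ger0_norm ?divr_ge0 ?subr_ge0 // -[ltRHS]mul1r ltr_pM2r ?invr_gt0 //.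
by rewrite ltrBlDl; move: u; rewrite intrD.
Qed.

Lemma grid_point_floor_ball k (y : 'rV[R]_d) e : k.+1%:R^-1 < e ->
  ball (grid_point k (grid_floor k y)) e y.
Proof.
move=> ke; split; first by apply: lt_trans ke.
move=> i j; rewrite ord1 /ball /= distrC.
exact: lt_trans (grid_point_floor_near _ _ _) ke.
Qed.

Lemma cvg_grid_point_floor (y : 'rV[R]_d) :
  grid_point k (grid_floor k y) @[k --> \oo] --> y.
Proof.
apply/cvg_ballP => e e0; near=> k.
apply: ball_sym; apply: grid_point_floor_ball.
by near: k; exact: (near_infty_natSinv_lt (PosNum e0)).
Unshelve. all: by end_near. Qed.

Section Maps.
Context {dT : measure_display} {T : measurableType dT}.

Definition measurable_rV (Y : T -> 'rV[R]_d) :=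
  forall j, measurable_fun setT (fun w => Y w 0 j).

Lemma measurable_grid_cell k (Y : T -> 'rV[R]_d) (q : 'rV[int]_d) :
  measurable_rV Y -> measurable [set w | grid_floor k (Y w) = q].
Proof.
move=> mY.
have -> : [set w | grid_floor k (Y w) = q] =
    \bigcap_(j in [set: 'I_d])
      ((fun w => k.+1%:R * Y w 0 j) @^-1` `[(q 0 j)%:~R, (q 0 j + 1)%:~R[).
  apply/seteqP; split => w /=.
    by move=> <- j _ /=; rewrite in_itv /= mxE floor_itv.
  move=> H; apply/rowP => j; rewrite mxE; apply/eqP; rewrite floor_eq.
  by have /= := H j I; rewrite in_itv.
apply: fin_bigcap_measurable => [|j _]; first exact: finite_finset.
rewrite -[X in measurable X]setTI.
have : measurable_fun setT (fun w => k.+1%:R * Y w 0 j).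
  by apply: measurable_funM.
by apply.
Qed.

(** An open set is the union, over all meshes, of the grid cells that it contains. This passes from
    measurable coordinates to the Borel sigma-algebra of the space. *)
Lemma measurable_fun_borel_rV (Y : T -> 'rV[R]_d) : measurable_rV Y ->
  measurable_fun setT (Y : T -> borel_rV R d).
Proof.
move=> mY; apply: (@measurability _ _ T (borel_rV R d) setT Y (@open 'rV[R]_d)) => //.
move=> _ [U oU <-].
rewrite setTI.
have -> : Y @^-1` U = \bigcup_(kq : nat * 'rV[int]_d)
    [set w | grid_floor kq.1 (Y w) = kq.2 /\
       forall z, grid_floor kq.1 z = kq.2 -> U z].
  apply/seteqP; split => w /=; last by case=> kq _ [] /[swap]; apply.
  move=> UY; have /nbhs_ballP[e /= e0 eU] := open_nbhs_nbhs (conj oU UY).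
  have [k ke] : exists k : nat, k.+1%:R^-1 < e / 2.
    have := near_infty_natSinv_lt (PosNum (divr_gt0 e0 (ltr0Sn _ 1))).
    by case=> N _ /(_ N (leqnn N)) h; exists N.
  exists (k, grid_floor k (Y w)) => //=; split=> // z zY; apply: eU.
  apply: (@ball_splitr _ _ (grid_point k (grid_floor k z))).
    by rewrite zY; exact: grid_point_floor_ball.
  exact: grid_point_floor_ball.
apply: countable_bigcupT_measurable => [|[k q]]; first exact: countableP.
have [H|H] := pselect (forall z, grid_floor k z = q -> U z).
  suff -> : [set w | grid_floor k (Y w) = q /\
      forall z, grid_floor k z = q -> U z] = [set w | grid_floor k (Y w) = q].
    exact: measurable_grid_cell.
  by apply/seteqP; split => w /= => [[]|].
suff -> : [set w | grid_floor k (Y w) = q /\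
  forall z, grid_floor k z = q -> U z] = set0 by exact: measurable0.
by apply/seteqP; split => w //= [].
Qed.

(* A function measurable in the first argument and continuous in the second
   is the limit of its values at the grid points below the second argument. *)
Lemma measurable_caratheodory (dS : measure_display) (S : measurableType dS)
    (psi : S -> 'rV[R]_d -> R) (g : T -> S) (Y : T -> 'rV[R]_d) :
  (forall y, measurable_fun setT (psi ^~ y)) -> (forall s, continuous (psi s)) ->
  measurable_fun setT g -> measurable_rV Y ->
  measurable_fun setT (fun w => psi (g w) (Y w)).
Proof.
move=> mpsi cpsi mg mY.
apply: (@measurable_fun_cvg _ _ _ setT
  (fun k w => psi (g w) (grid_point k (grid_floor k (Y w))))); last first.
  by move=> w _; apply: continuous_cvg; [exact: cpsi|exact: cvg_grid_point_floor].
move=> k _ B mB; rewrite setTI.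
have -> : (fun w => psi (g w) (grid_point k (grid_floor k (Y w)))) @^-1` B =
  \bigcup_(q : 'rV[int]_d) ([set w | grid_floor k (Y w) = q] `&`
     ((fun w => psi (g w) (grid_point k q)) @^-1` B)).
  by apply/seteqP; split => w /= => [h|[q _ [<-]] //]; exists (grid_floor k (Y w)).
apply: countable_bigcupT_measurable => [|q]; first exact: countableP.
apply: measurableI; first exact: measurable_grid_cell.
rewrite -[X in measurable X]setTI.
have : measurable_fun setT (fun w => psi (g w) (grid_point k q)).
  exact: (measurableT_comp (mpsi _) mg).
by apply.
Qed.

End Maps.

Lemma measurable_rV_borel : measurable_rV (fun y : borel_rV R d => y).
Proof.
move=> j; apply: (measurability (RGenOInfty.G (R := R))).
  exact: RGenOInfty.measurableE.
move=> _ [_ [a ->] <-]; rewrite setTI; apply: sub_sigma_algebra => /=.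
apply: open_comp; last exact: rray_open.
by move=> y _; exact: coord_continuous.
Qed.

End VectorMeasurability.

Section VectorMeasurabilityCalculus.
Context {R : realType} {d : nat} {dT : measure_display} {T : measurableType dT}.
Implicit Types (Y Z : T -> 'rV[R]_d) (k : T -> R).

Lemma measurable_rV_cst (y : 'rV[R]_d) : measurable_rV (fun _ : T => y).
Proof. by move=> j; exact: measurable_cst. Qed.

Lemma measurable_rVD Y Z : measurable_rV Y -> measurable_rV Z ->
  measurable_rV (fun w => Y w + Z w).
Proof.
move=> mY mZ j; under [X in measurable_fun _ X]eq_fun do rewrite mxE.
exact: measurable_funD.
Qed.

Lemma measurable_rVZ k Y : measurable_fun setT k -> measurable_rV Y ->
  measurable_rV (fun w => k w *: Y w).
Proof.
move=> mk mY j; under [X in measurable_fun _ X]eq_fun do rewrite mxE.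
exact: measurable_funM.
Qed.

Lemma measurable_rVB Y Z : measurable_rV Y -> measurable_rV Z ->
  measurable_rV (fun w => Y w - Z w).
Proof.
move=> mY mZ j; under [X in measurable_fun _ X]eq_fun do rewrite !mxE.
exact: measurable_funB.
Qed.

Lemma measurable_rV_sum (I : Type) (s : seq I) (Y : I -> T -> 'rV[R]_d) :
  (forall i, measurable_rV (Y i)) ->
  measurable_rV (fun w => \sum_(i <- s) Y i w).
Proof.
move=> mY j; under [X in measurable_fun _ X]eq_fun do rewrite summxE.
by apply: measurable_sum => i; exact: mY.
Qed.

Lemma measurable_rV_mulmx Y (A : T -> 'M[R]_d) : measurable_rV Y ->
  (forall i j, measurable_fun setT (fun w => A w i j)) ->
  measurable_rV (fun w => Y w *m A w).
Proof.
move=> mY mA j; under [X in measurable_fun _ X]eq_fun do rewrite mxE.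
by apply: measurable_sum => i; apply: measurable_funM.
Qed.

Lemma measurable_enorm Y : measurable_rV Y ->
  measurable_fun setT (fun w => enorm (Y w)).
Proof.
move=> mY; rewrite /enorm; apply: (measurableT_comp (f := @Num.sqrt R)).
  by apply: continuous_measurable_fun; exact: sqrt_continuous.
by apply: measurable_sum => i; apply: measurable_funX.
Qed.

Lemma measurable_average n (Y : 'I_n -> T -> 'rV[R]_d) :
  (forall i, measurable_rV (Y i)) ->
  measurable_rV (fun w => average (fun i => Y i w)).
Proof.
move=> mY; apply: measurable_rVZ; first exact: measurable_cst.
exact: measurable_rV_sum.
Qed.

Lemma measurable_normalize Y : measurable_rV Y ->
  measurable_rV (fun w => (enorm (Y w))^-1 *: Y w).
Proof.
move=> mY; apply: measurable_rVZ => //.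
(* The power with exponent -1 is measurable on the whole line and agrees with the inverse on
   nonnegative numbers, including the value 0 at 0. *)
under [X in measurable_fun _ X]eq_fun do rewrite -(powR_inv1 (enorm_ge0 _)).
by apply: (measurableT_comp (measurable_powR (-1))); exact: measurable_enorm.
Qed.

End VectorMeasurabilityCalculus.

(** * Gradients and Hessians of a random function at a random point *)

Section RandomFunctions.
Context {R : realType} {d : nat}.
Context {dS dT : measure_display} {S : measurableType dS} {T : measurableType dT}.
Variables (phi : S -> 'rV[R]_d -> R) (g : T -> S) (Y : T -> 'rV[R]_d).
Hypothesis dphi : forall s y, differentiable (grad (phi s)) y.
Hypothesis mphi : forall y, measurable_rV (fun s => grad (phi s) y).
Hypotheses (mg : measurable_fun setT g) (mY : measurable_rV Y).

Lemma measurable_grad : measurable_rV (fun w => grad (phi (g w)) (Y w)).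
Proof.
move=> j; apply: (@measurable_caratheodory _ _ _ _ _ _
  (fun s y => grad (phi s) y 0 j)) => // [y|s y]; first exact: mphi.
apply: (continuous_comp (g := fun z : 'rV[R]_d => z 0 j)).
  exact: differentiable_continuous.
exact: coord_continuous.
Qed.

(** Steps 1/(k+1) make the Hessian entry a limit of a sequence, so it inherits measurability from
    gradients. *)
Lemma hess_difference_quotient_cvg s (y : 'rV[R]_d) i j :
  k.+1%:R * (grad (phi s) (k.+1%:R^-1 *: delta_mx 0 i + y) 0 j
    - grad (phi s) y 0 j) @[k --> \oo] --> hess (phi s) y i j.
Proof.
have [+ +] := derive_grad_hess (delta_mx 0 i) j (dphi s y).
rewrite -rowE mxE => /cvg_ex[l hl] dE.
have lE : l = hess (phi s) y i j by rewrite -dE; apply/esym/cvg_lim.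
have -> : (fun k : nat => k.+1%:R * (grad (phi s)
      (k.+1%:R^-1 *: delta_mx 0 i + y) 0 j - grad (phi s) y 0 j)) =
    (fun k : nat => (k.+1%:R^-1)^-1 * (grad (phi s)
      (k.+1%:R^-1 *: delta_mx 0 i + y) 0 j - grad (phi s) y 0 j)).
  by apply/funext => k; rewrite invrK.
rewrite -lE; move/cvgr_dnbhsP : hl; apply; split; last exact: cvg_harmonic.
by move=> k; rewrite invr_eq0 pnatr_eq0.
Qed.

End RandomFunctions.

Section RandomHessian.
Context {R : realType} {d : nat}.
Context {dS dT : measure_display} {S : measurableType dS} {T : measurableType dT}.
Variables (phi : S -> 'rV[R]_d -> R) (g : T -> S) (Y : T -> 'rV[R]_d).
Hypothesis dphi : forall s y, differentiable (grad (phi s)) y.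
Hypothesis mphi : forall y, measurable_rV (fun s => grad (phi s) y).
Hypotheses (mg : measurable_fun setT g) (mY : measurable_rV Y).

Lemma measurable_hess i j :
  measurable_fun setT (fun w => hess (phi (g w)) (Y w) i j).
Proof.
apply: (@measurable_fun_cvg _ _ _ setT (fun k w =>
  k.+1%:R * (grad (phi (g w)) (k.+1%:R^-1 *: delta_mx 0 i + Y w) 0 j
    - grad (phi (g w)) (Y w) 0 j))); last first.
  by move=> w _; exact: hess_difference_quotient_cvg.
move=> k; apply: measurable_funM => //; apply: measurable_funB.
  apply: (measurable_grad dphi mphi mg).
  by apply: measurable_rVD => //; exact: measurable_rV_cst.
exact: (measurable_grad dphi mphi mg).
Qed.

End RandomHessian.

(** * Independence of generated sigma-algebras *)

Section Independence.
Context {R : realType} {dO : measure_display} {Omega : measurableType dO}.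
Variable P : probability Omega R.

(** Dynkin's pi-lambda theorem: for a fixed [A] the events independent of [A] form a Dynkin system,
    and it contains the intersection-closed class [G]. *)
Lemma independent_generated (H G : set (set Omega)) :
  H `<=` measurable -> G `<=` measurable -> setI_closed G ->
  independent P H G -> independent P H <<s G >>.
Proof.
move=> Hm Gm GI HG A B HA; have mA := Hm _ HA.
pose Q (B : set Omega) := (P (A `&` B) = P A * P B)%E.
have sm : <<s G >> `<=` @measurable _ Omega.
  by apply: smallest_sub => //; exact: sigma_algebra_measurable.
suff : <<s G >> `<=` [set B | measurable B /\ Q B] by move=> h /h [].
apply: lambda_system_subset => //; last first.
  by move=> C GC; split; [exact: Gm|exact: HG].
apply/dynkin_lambda_system; split.
- by split => //; rewrite /Q setIT probability_setT mule1.
- move=> C [mC QC]; split; first exact: measurableC.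
  have PAC : (P (A `\` C) = P A - P (A `&` C))%E.
    by apply: measureD => //; rewrite ltey_eq fin_num_measure.
  rewrite /Q -setDE PAC QC probability_setC // muleBr ?mule1 ?fin_num_measure //.
- move=> F tF FQ; split.
    by apply: bigcup_measurable => k _; case: (FQ k).
  rewrite /Q setI_bigcupr measure_bigcup //; first last.
  - exact: trivIset_setIl.
  - by move=> k _; apply: measurableI => //; case: (FQ k).
  rewrite measure_bigcup //; last by move=> k _; case: (FQ k).
  rewrite -(fineK (fin_num_measure P A mA)) -nneseriesZl //.
  by apply: eq_eseriesr => k _; rewrite fineK ?fin_num_measure //; case: (FQ k).
Qed.

(** Intersections of one event from each of the other classes form an intersection-closed class [C]
    that generates the same sigma-algebra, and on [C] the product formula gives independence
    directly. *)
Lemma mutually_independent_complement (I : finType) (G : I -> set (set Omega))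
    (k : I) :
  (forall i, G i `<=` measurable) -> (forall i, G i setT) ->
  (forall i, setI_closed (G i)) ->
  mutually_independent P G ->
  independent P (G k) <<s \bigcup_(i in [set i | i != k]) G i >>.
Proof.
move=> Gm GT GI indep.
pose C := [set B | exists2 A : I -> set Omega, (forall i, G i (A i)) &
  B = \big[setI/setT]_(i | i != k) A i].
have -> : <<s \bigcup_(i in [set i | i != k]) G i >> = <<s C >>.
  apply/seteqP; split; apply: smallest_sub;
    try exact: (@smallest_sigma_algebra _ setT).
    move=> B [i /= ik GB]; apply: sub_sigma_algebra.
    exists (fun j => if j == i then B else setT).
      by move=> j; case: eqP => [->|].
    by rewrite (bigD1 i) //= eqxx big1 ?setIT // => j /andP[_ /negbTE ->].
  move=> _ [A GA ->].
  apply: (@bigsetI_measurable _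
    (g_sigma_algebraType (\bigcup_(i in [set i | i != k]) G i))) => i ik.
  by apply: sub_sigma_algebra; exists i.
apply: independent_generated; first exact: Gm.
- move=> _ [A GA ->]; apply: bigsetI_measurable => i _; exact: Gm.
- move=> _ _ [A GA ->] [B GB ->]; exists (fun i => A i `&` B i).
    by move=> i; exact: GI.
  by rewrite big_split.
- move=> A _ GA [B GB ->].
  have BE i : i != k -> (if i == k then A else B i) = B i by move/negbTE->.
  have E1 : (fun i => i \in [set~ k]%SET) =1 (fun i => i != k).
    by move=> i; rewrite !inE.
  have E2 : (fun i => i \in [set: I]%SET) =1 xpredT by move=> i; rewrite inE.
  have PB : (P (\big[setI/setT]_(i | i != k) B i)
      = \prod_(i | i != k) P (B i))%E.
    by rewrite -!(eq_bigl _ _ E1); apply: indep => i _; exact: GB.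
  (* The product formula is used twice, over all indices with [A] placed at [k] and over the indices
     other than [k]; comparing the two isolates the factor [P A]. *)
  pose F i := if i == k then A else B i.
  have PF : (P (\big[setI/setT]_i F i) = \prod_i P (F i))%E.
    rewrite -(eq_bigl _ _ E2) -[in RHS](eq_bigl _ _ E2).
    by apply: indep => i _; rewrite /F; case: eqP => [->|].
  move: PF; rewrite (bigD1 k) //= [in RHS](bigD1 k) //= {1 3}/F eqxx PB.
  rewrite (eq_bigr B) => [->|i /BE //].
  by congr (_ * _)%E; apply: eq_bigr => i ik; rewrite /F (negbTE ik).
Qed.

End Independence.

(** * Step sizes *)

(** With r = sqrt(1 - alpha): [rho] is r / (1 - r), [rho'] is 1 / (1 - r), [q] is 1 / alpha^2, [s]
    is 1 / sqrt n, and [l] is the logarithm. The constant 32 comes from the noise that passes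
    through compression: its term 16 g l rho S becomes 32 g l q S by [rho <= 2 * q]. All other terms
    leave slack. *)
Lemma final_arithmetic (R : realFieldType)
    (D0 a b S s q rho rho' l g Lb Lhb L Lh : R) :
  0 <= D0 -> 0 <= a -> 0 <= b -> 0 <= S -> 0 <= s -> 1 <= q -> 0 <= rho ->
  rho <= rho' -> rho <= 2 * q -> 0 <= l -> 0 <= g -> 0 <= Lb -> 0 <= Lhb ->
  0 <= L -> 0 <= Lh ->
  3 * D0 + 3 / 2 * L * g ^+ 2
  + (2 * g * (rho * (a + b + 2 * l * (4 * S + Lhb * g ^+ 2 * (3 / 2) + Lb * g)))
     + 4 * g * S * s * (2 * l)
     + (2 * g ^+ 3 * Lhb + L / 2 * g ^+ 2) * (2 * l))
  <= 32 * (1 + l) * (D0 + 2 * g * rho' * a + 2 * g * rho * b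
     + g * (S * (s + q)) + g ^+ 2 * (L + Lb * q) + g ^+ 3 * (Lh + Lhb * q)).
Proof.
move=> D0p ap bp Sp sp q1 rhop rho1 rho2 lp gp Lbp Lhbp Lp Lhp.
have q0 : 0 <= q by lra.
have rho'0 : 0 <= rho' by lra.
have d1 : 0 <= rho' - rho by lra.
have d2 : 0 <= 2 * q - rho by lra.
have d3 : 0 <= q - 1 by lra.
have g2 := mulr_ge0 gp gp; have g3 := mulr_ge0 g2 gp.
have l1 : 0 <= 1 + l by lra.
(* The nonlinear part of the inequality: the slack of each bound on [rho] and [q], times a
   nonnegative monomial. With the monomials as atoms, the goal is a linear consequence. *)
have e1 := mulr_ge0 l1 (mulr_ge0 (mulr_ge0 gp ap) d1).
have e2 : 0 <= g * l * S * (2 * q - rho) by rewrite !mulr_ge0.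
have e3 : 0 <= g * g * g * l * Lhb * (2 * q - rho) by rewrite !mulr_ge0.
have e4 : 0 <= g * g * l * Lb * (2 * q - rho) by rewrite !mulr_ge0.
have e5 : 0 <= g * g * g * l * Lhb * (q - 1) by rewrite !mulr_ge0.
have m1 := mulr_ge0 D0p lp.
have m2 := mulr_ge0 (mulr_ge0 gp rhop) ap; have m3 := mulr_ge0 m2 lp.
have m4 := mulr_ge0 (mulr_ge0 gp rhop) bp; have m5 := mulr_ge0 m4 lp.
have m6 := mulr_ge0 (mulr_ge0 gp Sp) sp; have m7 := mulr_ge0 m6 lp.
have m8 := mulr_ge0 (mulr_ge0 gp Sp) q0; have m9 := mulr_ge0 m8 lp.
have m10 := mulr_ge0 g2 Lp; have m11 := mulr_ge0 m10 lp.
have m12 := mulr_ge0 (mulr_ge0 g2 Lbp) q0; have m13 := mulr_ge0 m12 lp.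
have m14 := mulr_ge0 g3 Lhp; have m15 := mulr_ge0 m14 lp.
have m16 := mulr_ge0 (mulr_ge0 g3 Lhbp) q0; have m17 := mulr_ge0 m16 lp.
rewrite !exprS expr0; lra.
Qed.

Section StepSizes.
Context {R : realType}.
Local Notation eta := (decay R).

Lemma natr_div_succ (t : nat) : t%:R / t.+1%:R = 1 - t.+1%:R^-1 :> R.
Proof.
have y0 : t.+1%:R != 0 :> R by rewrite pnatr_eq0.
by rewrite -{1}[t%:R](addrK 1) natr1; field.
Qed.

Lemma decay_base_bounds (t : nat) : 0 < (2 / t.+2%:R : R) <= 1.
Proof. by rewrite divr_gt0 //= ler_pdivrMr ?ltr0n // mul1r ler_nat. Qed.

Lemma decay_gt0 t : 0 < eta t.
Proof. by rewrite powR_gt0 //; case/andP: (decay_base_bounds t). Qed.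

Lemma decay_ge0 t : 0 <= eta t.
Proof. exact/ltW/decay_gt0. Qed.

Lemma decay0 : eta 0 = 1.
Proof. by rewrite /decay divff ?pnatr_eq0 // powR1. Qed.

Lemma decay_ge_base t : 2 / t.+2%:R <= eta t.
Proof.
have /andP[b0 b1] := decay_base_bounds t.
rewrite -[leLHS]powRr1 ?(ltW b0) //; apply: ger_powR => //.
  by rewrite b0.
by rewrite ler_pdivrMr // mul1r ler_nat.
Qed.

Lemma decay_le1 t : eta t <= 1.
Proof.
have /andP[b0 b1] := decay_base_bounds t.
rewrite -(powRr0 (2 / t.+2%:R)); apply: ger_powR; first by rewrite b0.
by rewrite divr_ge0.
Qed.

Lemma decay_sqr_le t : eta t ^+ 2 <= 2 / t.+2%:R.
Proof.
have /andP[b0 b1] := decay_base_bounds t.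
rewrite -powR_mulrn ?decay_ge0 // -powRrM -[leRHS]powRr1 ?(ltW b0) //.
apply: ger_powR; first by rewrite b0.
by lra.
Qed.

Lemma decay_mul_sqrt t : eta t * Num.sqrt (eta t) = 2 / t.+2%:R.
Proof.
have /andP[b0 b1] := decay_base_bounds t.
rewrite -powR12_sqrt ?decay_ge0 // -powRrM -powRD; last first.
  by rewrite (gt_eqF b0) implybT.
have -> : 2 / 3 + 2 / 3 / 2 = 1 :> R by lra.
by rewrite powRr1 // ltW.
Qed.

(** As 2/3 <= 1, consecutive values have ratio at least (t+2)/(t+3). The relative decrease is thus
    at most 1/(t+3), and 2/(t+3) <= 2/(t+2) <= [eta t]. *)
Lemma decay_step t : 2 * (eta t - eta t.+1) <= eta t ^+ 2.
Proof.
have /andP[b0 b1] := decay_base_bounds t.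
have r0 : 0 < t.+2%:R / t.+3%:R :> R by rewrite divr_gt0.
have r1 : t.+2%:R / t.+3%:R <= 1 :> R.
  by rewrite ler_pdivrMr // mul1r ler_nat.
have etaS : eta t.+1 = eta t * (t.+2%:R / t.+3%:R) `^ (2 / 3).
  rewrite /decay -powRM ?ltW //; congr (_ `^ _).
  by rewrite mulrA divfK // pnatr_eq0.
have rp : t.+2%:R / t.+3%:R <= (t.+2%:R / t.+3%:R) `^ (2 / 3) :> R.
  rewrite -[leLHS]powRr1 ?(ltW r0) //; apply: ger_powR.
    by rewrite r0.
  by rewrite ler_pdivrMr // mul1r ler_nat.
have -> : 2 * (eta t - eta t.+1)
  = eta t * (2 * (1 - (t.+2%:R / t.+3%:R) `^ (2 / 3))).
  by rewrite etaS; ring.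
rewrite expr2 ler_wpM2l ?decay_ge0 //.
apply: le_trans (decay_ge_base t).
apply: (@le_trans _ _ (2 * (1 - t.+2%:R / t.+3%:R))).
  by rewrite ler_wpM2l // lerD2l lerN2.
rewrite ler_wpM2l //.
have -> : 1 - t.+2%:R / t.+3%:R = t.+3%:R^-1 :> R.
  by rewrite natr_div_succ subKr.
by rewrite lef_pV2 ?posrE // ler_nat.
Qed.

Lemma decay_decr t : eta t.+1 <= eta t.
Proof.
have /andP[b0 b1] := decay_base_bounds t.
have /andP[b0' _] := decay_base_bounds t.+1.
apply: ge0_ler_powR; rewrite ?nnegrE ?divr_ge0 //.
by rewrite ler_pM2l // lef_pV2 ?posrE // ler_nat.
Qed.

(** The bound 2 eta reproduces itself: (1 - eta) 2 eta + eta^2 = 2 eta - eta^2, and by [decay_step]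
    the gain eta^2 covers the decrease of 2 eta to its next value. *)
Lemma decay_recursion (a : nat -> R) : a 1 <= 1 ->
  (forall t, a t.+1 <= (1 - eta t) * a t + eta t ^+ 2) ->
  forall t, a t.+1 <= 2 * eta t.+1.
Proof.
move=> a1 aS; elim => [|t IH].
  apply: le_trans a1 _; apply: le_trans (ler_wpM2l _ (decay_ge_base 1)) => //.
  by lra.
apply: le_trans (aS _) _.
have := ler_wpM2l _ IH (x := 1 - eta t.+1); rewrite subr_ge0 decay_le1.
move=> /(_ isT); have := decay_step t.+1.
rewrite expr2; lra.
Qed.

(** Telescoping, with ln(1 + x) <= x at x = -1/(t+2). *)
Lemma sum_inv_le_ln (T : nat) :
  \sum_(t < T) t.+2%:R^-1 <= ln T.+1%:R :> R.
Proof.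
elim: T => [|T IH]; first by rewrite big_ord0 ln1.
rewrite big_ord_recr /=; apply: le_trans (lerD IH (lexx _)) _.
have -> : T.+1%:R = T.+2%:R * (T.+1%:R / T.+2%:R) :> R.
  by rewrite mulrC divfK // pnatr_eq0.
rewrite lnM ?posrE ?divr_gt0 // -addrA gerDl.
have : T.+1%:R / T.+2%:R = 1 + - T.+2%:R^-1 :> R.
  exact: natr_div_succ.
move=> ->; have := @le_ln1Dx R (- T.+2%:R^-1).
rewrite ltrN2 invf_lt1 // ltr1n => /(_ isT).
by rewrite -lerBrDr sub0r.
Qed.

(** Every term is at least the last one, (2/(T+1))^(2/3) >= T^(-2/3), and there are T of them. *)
Lemma sum_decay_ge (T : nat) : (0 < T)%N ->
  T%:R `^ (3^-1) <= \sum_(t < T) eta t.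
Proof.
case: T => // T _; have T0 : 0 < T.+1%:R :> R by [].
have mono (t : nat) : (t <= T)%N -> eta T <= eta t.
  elim: T {T0} => [|T IH]; first by rewrite leqn0 => /eqP ->.
  rewrite leq_eqVlt => /predU1P[->//|]; rewrite ltnS => /IH.
  exact/le_trans/decay_decr.
apply: (@le_trans _ _ (\sum_(t < T.+1) eta T)); last first.
  by apply: ler_sum => t _; apply: mono; rewrite -ltnS.
rewrite sumr_const card_ord -[leRHS]mulr_natl.
have -> : T.+1%:R `^ (3^-1) = T.+1%:R * (T.+1%:R^-1) `^ (2 / 3) :> R.
  rewrite -(powR_inv1 (ltW T0)) -powRrM -[X in X * _ `^ _]powRr1 ?ltW //.
  rewrite -powRD; last by rewrite (gt_eqF T0) implybT.
  by congr (_ `^ _); lra.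
rewrite ler_pM2l //; apply: ge0_ler_powR;
  rewrite ?nnegrE ?divr_ge0 ?invr_ge0 //.
rewrite ler_pdivlMr // mulrC ler_pdivrMr // -natrM ler_nat.
by rewrite ltn_Pmull.
Qed.

End StepSizes.

(* [decay_weight] dominates both weights produced by unrolling the momentum
   recursion: that of the noise variances (with [(1 - eta) ^+ 2] for [1 - eta])
   and that of the Taylor remainders. *)
Section DecayWeight.
Variable R : realType.

Fixpoint decay_weight (t : nat) : R :=
  if t is t'.+1 then (1 - decay R t') * decay_weight t' + decay R t' ^+ 2
  else 0.

Lemma decay_weight_ge0 t : 0 <= decay_weight t.
Proof.
elim: t => //= t IH.
by rewrite addr_ge0 ?sqr_ge0 // mulr_ge0 // subr_ge0 decay_le1.
Qed.

Lemma decay_weight_le t : decay_weight t.+1 <= 2 * decay R t.+1.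
Proof. by apply: decay_recursion => //=; rewrite decay0 mulr0 add0r expr1n. Qed.

Lemma decay_weight_le2 t : decay_weight t <= 2.
Proof.
case: t => [|t]; first by [].
apply: le_trans (decay_weight_le t) _.
by rewrite -[leRHS]mulr1 ler_wpM2l // decay_le1.
Qed.

(** A self-bounding argument: replacing the weight [decay R t.+1] by the larger [decay R t] makes
    the sum [S] reappear on the right with factor [r], and the inequality is solved for [S]. No
    double geometric sum is unrolled. *)
Lemma sum_decay_geometric (r eps Q : R) (Gam : nat -> R) (T : nat) :
  0 <= r < 1 -> 0 <= eps -> 0 <= Q -> (forall t, 0 <= Gam t) ->
  (forall t, Gam t.+1 = r * (Gam t + (t == 0)%:R * eps + decay R t * Q)) ->
  \sum_(t < T) decay R t.+1 * Gam t.+1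
  <= r / (1 - r) * (Gam 0 + eps + Q * \sum_(t < T) decay R t ^+ 2).
Proof.
move=> /andP[r0 r1] eps0 Q0 Gam0 GamS.
set S := (X in X <= _).
have S0 : 0 <= S by apply: sumr_ge0 => t _; rewrite mulr_ge0 ?decay_ge0.
suff H : S <= r * (Gam 0 + eps + S + Q * \sum_(t < T) decay R t ^+ 2).
  rewrite mulrAC ler_pdivlMr ?subr_gt0 //; lra.
apply: (@le_trans _ _ (r * \sum_(t < T)
    (decay R t * Gam t + (t == 0 :> nat)%:R * eps + Q * decay R t ^+ 2))).
  rewrite mulr_sumr; apply: ler_sum => t _; rewrite GamS mulrCA.
  apply: ler_wpM2l => //.
  apply: (@le_trans _ _ (decay R t *
      (Gam t + (t == 0 :> nat)%:R * eps + decay R t * Q))).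
    apply: ler_wpM2r; last exact: decay_decr.
    by rewrite !addr_ge0 ?mulr_ge0 ?decay_ge0.
  rewrite !mulrDr -!addrA lerD2l.
  have -> : decay R t * (decay R t * Q) = Q * decay R t ^+ 2 by ring.
  rewrite lerD2r; case: eqP => [->|_]; last by rewrite !mul0r mulr0.
  by rewrite decay0 mul1r.
apply: ler_wpM2l => //; rewrite !big_split /= -mulr_sumr.
apply: lerD => //.
rewrite /S; case: T {S S0} => [|T].
  by rewrite !big_ord0 !addr0 addr_ge0.
(* Shifting the index splits off [Gam 0] with weight 1; the last term of [S] is left over and
   dropped. *)
rewrite big_ord_recl decay0 mul1r.
rewrite [X in _ + X](big_ord_recl T) /= mul1r.
rewrite [X in _ + (_ + X)]big1 ?addr0 => [|t _]; last by rewrite mul0r.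
rewrite -!addrA lerD2l [leRHS]addrC lerD2r big_ord_recr /= lerDl.
by rewrite mulr_ge0 ?decay_ge0.
Qed.

End DecayWeight.

(** * One step of the algorithm *)

Section AverageGradient.
Context {R : realType} {n d : nat}.
Variable f : 'I_n -> 'rV[R]_d -> R.
Local Notation F := (fun y => raverage (fun i => f i y)).

Let raverageE : F = n%:R^-1 *: \sum_(i < n) f i.
Proof.
apply/funext => y.
have -> : (n%:R^-1 *: \sum_(i < n) f i) y = n%:R^-1 * (\sum_(i < n) f i) y by [].
by rewrite fct_sumE.
Qed.

Lemma differentiable_raverage x : (forall i y, differentiable (f i) y) ->
  differentiable F x.
Proof.
by move=> df; rewrite raverageE; apply/differentiableZ/differentiable_sum.
Qed.

Lemma grad_raverage x : (forall i y, differentiable (f i) y) ->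
  grad F x = average (fun i => grad (f i) x).
Proof.
move=> df; apply/rowP => j; rewrite raverageE !mxE summxE.
rewrite deriveZ ?derive_sum; last 2 first.
- by move=> i; exact: diff_derivable.
- by apply: diff_derivable; exact: differentiable_sum.
by congr (_ * _); apply: eq_bigr => i _; rewrite mxE.
Qed.

End AverageGradient.

Section Averages.
Context {R : realType} {n : nat}.

Lemma averageD (V : lmodType R) (u v : 'I_n -> V) :
  average (fun i => u i + v i) = average u + average v.
Proof. by rewrite /average big_split scalerDr. Qed.

Lemma averageB (V : lmodType R) (u v : 'I_n -> V) :
  average (fun i => u i - v i) = average u - average v.
Proof. by rewrite /average sumrB scalerBr. Qed.

Lemma raverageD (a b : 'I_n -> R) :
  raverage (fun i => a i + b i) = raverage a + raverage b.
Proof. by rewrite /raverage big_split mulrDr. Qed.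

Lemma raverageZ k (a : 'I_n -> R) :
  raverage (fun i => k * a i) = k * raverage a.
Proof. by rewrite /raverage -mulr_sumr mulrCA. Qed.

Lemma raverageZr k (a : 'I_n -> R) :
  raverage (fun i => a i * k) = raverage a * k.
Proof. by rewrite /raverage -mulr_suml mulrA. Qed.

Lemma ler_raverage (a b : 'I_n -> R) : (forall i, a i <= b i) ->
  raverage a <= raverage b.
Proof. by move=> ab; rewrite ler_wpM2l ?invr_ge0 // ler_sum. Qed.

Lemma raverage_ge0 (a : 'I_n -> R) : (forall i, 0 <= a i) -> 0 <= raverage a.
Proof. by move=> a0; rewrite mulr_ge0 ?invr_ge0 // sumr_ge0. Qed.

Lemma raverage_const (k : R) : (0 < n)%N -> raverage (fun _ : 'I_n => k) = k.
Proof.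
move=> n0; rewrite /raverage sumr_const card_ord -[k *+ n]mulr_natl mulKf //.
by rewrite pnatr_eq0 -lt0n.
Qed.

End Averages.

Section MomentumIdentities.
Context {R : realType} {d : nat}.
Implicit Types (v h a b : 'rV[R]_d) (k : R).

(** Here [a] and [b] are the true gradients at the new and the old point, [a1] is the sampled
    gradient, and [h], [h1] are the true and sampled Hessians applied to the step. The result is
    noise plus the discounted sum of the old error [v - b] and the Taylor remainder [b - a + h]. *)
Lemma momentum_error_identity v h a b (h1 a1 : 'rV[R]_d) k :
  (1 - k) *: (v + h1) + k *: a1 - a
  = (1 - k) *: (h1 - h) + k *: (a1 - a) + (1 - k) *: (v - b + (b - a + h)).
Proof.
apply/rowP => j; rewrite !mxE.
move: (v 0 j) (h 0 j) (h1 0 j) (a1 0 j) (a 0 j) (b 0 j).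
by move=> *; ring.
Qed.

Lemma momentum_increment_identity v h a b (h1 a1 : 'rV[R]_d) k :
  (1 - k) *: (v + h1) + k *: a1 - v
  = (1 - k) *: (h1 - h) + k *: (a1 - a) - k *: (v - b)
    + ((1 - k) *: (b - a + h) + (a - b)).
Proof.
apply/rowP => j; rewrite !mxE.
move: (v 0 j) (h 0 j) (h1 0 j) (a1 0 j) (a 0 j) (b 0 j).
by move=> *; ring.
Qed.

End MomentumIdentities.

Section OneStep.
Context {R : realType} {n d : nat}.
Variables (gamma eta : nat -> R).
Implicit Types (s : ef21_state R n d) (t : nat).
Hypothesis gamma_ge0 : forall t, 0 <= gamma t.
Hypothesis eta01 : forall t, 0 <= eta t <= 1.

Lemma step_length_le t s : enorm (ef21_step_x gamma t s - st_x s) <= gamma t.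
Proof.
rewrite /ef21_step_x addrAC subrr add0r enormN enormZ ger0_norm //.
by rewrite ler_piMr // enorm_normalize_le1.
Qed.

(* The martingale increment of [ef21_step_v] for a step [u] of [x] that ends
   at [y]. *)
Definition sampling_noise (a : R) (psi f : 'rV[R]_d -> R) (y u : 'rV[R]_d) :=
  (1 - a) *: (u *m (hess psi y - hess f y)) + a *: (grad psi y - grad f y).

(** The Hessian is evaluated at the new iterate, so the Taylor expansion is centred there and the
    displacement is [- u]. *)
Lemma estimator_error_step (phi f : 'I_n -> 'rV[R]_d -> R) t s i :
  let x' := ef21_step_x gamma t s in let u := x' - st_x s in
  ef21_step_v gamma eta phi t s i - grad (f i) x' =
  sampling_noise (eta t) (phi i) (f i) x' u
  + (1 - eta t) *: (st_v s i - grad (f i) (st_x s)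
     + (grad (f i) (x' + - u) - grad (f i) x' - - u *m hess (f i) x')).
Proof.
move=> x' u; have -> : x' + - u = st_x s by rewrite /u opprB addrC subrK.
rewrite /ef21_step_v -/x' -/u /sampling_noise mulmxBr mulNmx opprK.
exact: momentum_error_identity.
Qed.

Lemma estimator_increment_step (phi f : 'I_n -> 'rV[R]_d -> R) t s i :
  let x' := ef21_step_x gamma t s in let u := x' - st_x s in
  ef21_step_v gamma eta phi t s i - st_v s i =
  sampling_noise (eta t) (phi i) (f i) x' u
  - eta t *: (st_v s i - grad (f i) (st_x s))
  + ((1 - eta t) *: (grad (f i) (x' + - u) - grad (f i) x' - - u *m hess (f i) x')
     + (grad (f i) x' - grad (f i) (st_x s))).
Proof.
move=> x' u; have -> : x' + - u = st_x s by rewrite /u opprB addrC subrK.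
rewrite /ef21_step_v -/x' -/u /sampling_noise mulmxBr mulNmx opprK.
exact: momentum_increment_identity.
Qed.

Section SmoothStep.
Variables (f : 'I_n -> 'rV[R]_d -> R) (Li Lhi : 'I_n -> R).
Hypothesis df : forall i, twice_differentiable (f i).
Hypothesis lf : forall i, lipschitz_grad (Li i) (f i).
Hypothesis lhf : forall i, lipschitz_hess (Lhi i) (f i).
Hypothesis Li0 : forall i, 0 <= Li i.
Hypothesis Lhi0 : forall i, 0 <= Lhi i.

Lemma taylor_remainder_step t s i :
  let x' := ef21_step_x gamma t s in let u := x' - st_x s in
  enorm (grad (f i) (x' + - u) - grad (f i) x' - - u *m hess (f i) x')
    <= Lhi i / 2 * gamma t ^+ 2.
Proof.
move=> /=; set x' := ef21_step_x gamma t s; set u := x' - st_x s.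
apply: le_trans (lipschitz_hess_taylor x' (- u) (Lhi0 i) _ (lhf i)) _.
  by case: (df i).
rewrite enormN ler_wpM2l ?divr_ge0 // ler_pXn2r ?nnegrE ?enorm_ge0 //.
exact: step_length_le.
Qed.

(** Intended for [w] the discounted noise up to time [t]: the new noise cancels exactly, and what
    remains obeys a deterministic recursion on every path. *)
Lemma estimator_error_step_le (phi : 'I_n -> 'rV[R]_d -> R) t s i (w : 'rV[R]_d) r :
  let x' := ef21_step_x gamma t s in let u := x' - st_x s in
  enorm (st_v s i - grad (f i) (st_x s) - w) <= r ->
  enorm (ef21_step_v gamma eta phi t s i - grad (f i) x'
    - ((1 - eta t) *: w + sampling_noise (eta t) (phi i) (f i) x' u))
  <= (1 - eta t) * (r + Lhi i / 2 * gamma t ^+ 2).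
Proof.
move=> x' u er; have /andP[_ e1] := eta01 t.
rewrite estimator_error_step -/x' -/u; set N := sampling_noise _ _ _ _ _.
have := taylor_remainder_step t s i; rewrite /= -/x' -/u.
set rem := (X in enorm X) => hrem; set e := (_ - grad _ (st_x s)) in er *.
have -> : N + (1 - eta t) *: (e + rem) - ((1 - eta t) *: w + N)
    = (1 - eta t) *: ((e - w) + rem).
  by rewrite opprD addrA addrAC (addrAC N) subrr add0r -scalerBr addrAC.
rewrite enormZ ger0_norm ?subr_ge0 // ler_wpM2l ?subr_ge0 //.
by apply: le_trans (ler_enormD _ _) _; apply: lerD.
Qed.

Lemma estimator_increment_step_le (phi : 'I_n -> 'rV[R]_d -> R) t s i :
  let x' := ef21_step_x gamma t s in let u := x' - st_x s in
  enorm (ef21_step_v gamma eta phi t s i - st_v s i)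
  <= enorm (sampling_noise (eta t) (phi i) (f i) x' u)
     + eta t * enorm (st_v s i - grad (f i) (st_x s))
     + (Lhi i / 2 * gamma t ^+ 2 + Li i * gamma t).
Proof.
move=> /=; set x' := ef21_step_x gamma t s; set u := x' - st_x s.
have /andP[e0 e1] := eta01 t.
rewrite (estimator_increment_step phi f) -/x' -/u.
have := taylor_remainder_step t s i; rewrite /= -/x' -/u.
set rem := (X in enorm X) => hrem.
apply: le_trans (ler_enormD _ _) _; apply: lerD.
  apply: le_trans (ler_enormB _ _) _; rewrite lerD2l enormZ ger0_norm //.
apply: le_trans (ler_enormD _ _) _; apply: lerD.
  rewrite enormZ ger0_norm ?subr_ge0 //; apply: le_trans hrem.
  by rewrite ler_piMl ?enorm_ge0 // gerBl.
apply: le_trans (lf _ _ _) _; rewrite ler_wpM2l //; exact: step_length_le.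
Qed.

End SmoothStep.

(** The factor 2 counts the error of [gbar] twice: once in the inner product of [G - gbar] with the
    step, once when the norm of [gbar] is traded for that of [G]. The case [gbar = 0] is covered by
    [dot_normalize]. *)
Lemma normalized_descent (F : 'rV[R]_d -> R) L t s : 0 <= L ->
  (forall y, differentiable F y) -> lipschitz_grad L F ->
  let gbar := average (st_g s) in
  F (ef21_step_x gamma t s) + gamma t * enorm (grad F (st_x s))
  <= F (st_x s) + 2 * gamma t * enorm (grad F (st_x s) - gbar)
     + L / 2 * gamma t ^+ 2.
Proof.
move=> L0 dF lF /=; set gbar := average (st_g s); set G := grad F (st_x s).
have := lipschitz_grad_descent (st_x s) (ef21_step_x gamma t s - st_x s) dF lF.
rewrite addrC subrK -/G => H.
have ul := step_length_le t s; set u := (X in enorm X) in ul H.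
have g0 := gamma_ge0 t.
have uE : dot gbar u = - (gamma t * enorm gbar).
  by rewrite /u /ef21_step_x addrAC subrr add0r dotNr dotZr dot_normalize.
have dE : dot G u = dot (G - gbar) u + dot gbar u by rewrite dotDl dotNl addrNK.
have d1 : dot (G - gbar) u <= gamma t * enorm (G - gbar).
  by apply: le_trans (dot_le_enorm _ _) _; rewrite mulrC ler_wpM2r ?enorm_ge0.
have u2 : L / 2 * enorm u ^+ 2 <= L / 2 * gamma t ^+ 2.
  by rewrite ler_wpM2l ?divr_ge0 // ler_pXn2r ?nnegrE ?enorm_ge0.
have tri : gamma t * enorm G <= gamma t * enorm (G - gbar) + gamma t * enorm gbar.
  rewrite -mulrDr ler_wpM2l //; apply: le_trans (ler_enormD _ _).
  by rewrite subrK.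
by lra.
Qed.

(** Depends on the length of the step but not on its direction; meant for the first step, whose
    direction may be arbitrarily bad. *)
Lemma step_increase_le (F : 'rV[R]_d -> R) L t s : 0 <= L ->
  (forall y, differentiable F y) -> lipschitz_grad L F ->
  F (ef21_step_x gamma t s)
  <= F (st_x s) + gamma t * enorm (grad F (st_x s)) + L / 2 * gamma t ^+ 2.
Proof.
move=> L0 dF lF; set G := grad F (st_x s).
have := lipschitz_grad_descent (st_x s) (ef21_step_x gamma t s - st_x s) dF lF.
rewrite addrC subrK -/G => H.
have ul := step_length_le t s; set u := (X in enorm X) in ul H.
have d1 : dot G u <= gamma t * enorm G.
  by apply: le_trans (dot_le_enorm _ _) _; rewrite mulrC ler_wpM2r ?enorm_ge0.
have u2 : L / 2 * enorm u ^+ 2 <= L / 2 * gamma t ^+ 2.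
  by rewrite ler_wpM2l ?divr_ge0 // ler_pXn2r ?nnegrE ?enorm_ge0.
by lra.
Qed.

End OneStep.

(* Comparing [F x] with the value after a normalized gradient step of length
   [g] bounds the gradient by the suboptimality gap. *)
Lemma gradient_le_gap (R : realType) (d : nat) (F : 'rV[R]_d -> R) L g x :
  0 <= L -> 0 <= g -> (forall y, differentiable F y) -> lipschitz_grad L F ->
  has_lbound (range F) ->
  g * enorm (grad F x) <= F x - inf (range F) + L / 2 * g ^+ 2.
Proof.
move=> L0 g0 dF lF Fb; set G := grad F x.
have := lipschitz_grad_descent x (- (g *: ((enorm G)^-1 *: G))) dF lF.
set y := x + _; set u := - _; rewrite -/G => H.
have Fy : inf (range F) <= F y by apply: ge_inf => //; exists y.
have dE : dot G u = - (g * enorm G).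
  by rewrite /u dotNr dotZr dot_normalize.
have ul : enorm u <= g.
  by rewrite /u enormN enormZ ger0_norm // ler_piMr // enorm_normalize_le1.
have u2 : L / 2 * enorm u ^+ 2 <= L / 2 * g ^+ 2.
  by rewrite ler_wpM2l ?divr_ge0 // ler_pXn2r ?nnegrE ?enorm_ge0.
by lra.
Qed.

(** * Sampling noise *)

Section Means.
Context {R : realType} {dX : measure_display} {X : measurableType dX}.
Variable D : probability X R.
Implicit Types (Y : X -> R) (m k : R).

Lemma has_mean_cst k : has_mean D (fun=> k) k.
Proof.
split; last exact: expectation_const.
exact: finite_measure_integrable_cst.
Qed.

Lemma has_meanD Y1 Y2 m1 m2 : has_mean D Y1 m1 -> has_mean D Y2 m2 ->
  has_mean D (fun s => Y1 s + Y2 s) (m1 + m2).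
Proof.
move=> [i1 e1] [i2 e2]; split.
  by apply: eq_integrable (integrableD measurableT i1 i2).
rewrite unlock in e1 e2 *; under eq_integral do rewrite EFinD.
by rewrite (integralD measurableT i1 i2) e1 e2.
Qed.

Lemma has_meanZ k Y m : has_mean D Y m -> has_mean D (fun s => k * Y s) (k * m).
Proof.
move=> [iY eY]; split.
  by apply: eq_integrable (integrableZl measurableT k iY).
rewrite unlock in eY *; under eq_integral do rewrite EFinM.
by rewrite (integralZl measurableT iY) eY.
Qed.

Lemma has_mean_sum (I : Type) (s : seq I) (Y : I -> X -> R) (m : I -> R) :
  (forall i, has_mean D (Y i) (m i)) ->
  has_mean D (fun z => \sum_(i <- s) Y i z) (\sum_(i <- s) m i).
Proof.
move=> H; elim: s => [|i s IH].
  rewrite big_nil; under eq_fun do rewrite big_nil; exact: has_mean_cst.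
rewrite big_cons; under eq_fun do rewrite big_cons; exact: has_meanD.
Qed.

Lemma has_mean_measurable Y m : has_mean D Y m -> measurable_fun setT Y.
Proof. by move=> [/integrableP[/measurable_EFinP]]. Qed.

Section Centered.
Context {d : nat}.
Variable N : X -> 'rV[R]_d.
Hypothesis N0 : forall j, has_mean D (fun s => N s 0 j) 0.

Lemma centered_measurable : measurable_rV N.
Proof. by move=> j; exact: has_mean_measurable (N0 j). Qed.

(** The cross term has mean zero. The bound on the second moment also makes it finite, so the
    expanded square is a sum of integrable functions. *)
Lemma centered_shift_sqr (w : 'rV[R]_d) (b B : R) :
  ('E_D[fun s => (enorm (N s) ^+ 2)%R] <= B%:E)%E ->
  ('E_D[fun s => (enorm (w + b *: N s) ^+ 2)%R]
     <= (enorm w ^+ 2 + b ^+ 2 * B)%:E)%E.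
Proof.
move=> NB.
have dot0 : has_mean D (fun s => dot w (N s)) 0.
  have z : \sum_(j < d) (0 : R) = 0 by rewrite big1.
  rewrite -[X in has_mean _ _ X]z.
  by apply: has_mean_sum => j; rewrite -(mulr0 (w 0 j)); exact: has_meanZ.
have mN2 : measurable_fun setT (fun s => enorm (N s) ^+ 2).
  exact/measurable_funX/measurable_enorm/centered_measurable.
have E0 : (0 <= 'E_D[fun s => (enorm (N s) ^+ 2)%R])%E.
  by apply: expectation_ge0 => s; apply: sqr_ge0.
have Efin : ('E_D[fun s => (enorm (N s) ^+ 2)%R])%E \is a fin_num.
  by rewrite ge0_fin_numE //; apply: le_lt_trans NB _; rewrite ltry.
pose m := fine ('E_D[fun s => (enorm (N s) ^+ 2)%R])%E.
have N2 : has_mean D (fun s => enorm (N s) ^+ 2) m.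
  split; last by rewrite fineK.
  apply/integrableP; split; first exact/measurable_EFinP.
  move: Efin; rewrite unlock ge0_fin_numE; last first.
    by apply: integral_ge0 => s _; rewrite lee_fin sqr_ge0.
  by under [X in (_ -> X < _)%E]eq_integral do
    rewrite /= ger0_norm ?sqr_ge0 //.
have mB : m <= B by rewrite -lee_fin fineK.
have [_] : has_mean D (fun s => enorm (w + b *: N s) ^+ 2)
    (enorm w ^+ 2 + (2 * b * 0 + b ^+ 2 * m)).
  have -> : (fun s => enorm (w + b *: N s) ^+ 2)
      = (fun s => enorm w ^+ 2 + (2 * b * dot w (N s) + b ^+ 2 * enorm (N s) ^+ 2)).
    apply/funext => s; rewrite !enorm_sqr dotDl !dotDr !dotZl !dotZr.
    by rewrite (dotC (N s) w); ring.
  apply: has_meanD (has_mean_cst _) _.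
  by apply: has_meanD; exact: has_meanZ.
move=> ->; rewrite lee_fin mulr0 add0r lerD2l ler_wpM2l ?sqr_ge0 //.
Qed.

End Centered.
End Means.

Section ClientNoise.
Context {R : realType} {d : nat} {dX : measure_display} {X : measurableType dX}.
Variables (D : probability X R) (psi : X -> 'rV[R]_d -> R) (f : 'rV[R]_d -> R).
Variables (sigma_g sigma_h : R).
Hypothesis mean_grad :
  forall y, has_mean_mx D (fun s => grad (psi s) y) (grad f y).
Hypothesis var_grad : forall y,
  ('E_D[fun s => (enorm (grad (psi s) y - grad f y) ^+ 2)%R]
     <= (sigma_g ^+ 2)%:E)%E.
Hypothesis mean_hess :
  forall y, has_mean_mx D (fun s => hess (psi s) y) (hess f y).
Hypothesis var_hess : forall y,
  ('E_D[fun s => (spectral_norm (hess (psi s) y - hess f y) ^+ 2)%R]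
     <= (sigma_h ^+ 2)%:E)%E.

Lemma noise_centered a y u j :
  has_mean D (fun s => sampling_noise a (psi s) f y u 0 j) 0.
Proof.
have centered (Y : X -> R) m : has_mean D Y m -> has_mean D (fun s => Y s - m) 0.
  by move=> H; rewrite -(subrr m); exact: has_meanD H (has_mean_cst D (- m)).
have -> : (fun s => sampling_noise a (psi s) f y u 0 j) = (fun s =>
   (1 - a) * (\sum_i u 0 i * (hess (psi s) y i j - hess f y i j))
   + a * (grad (psi s) y 0 j - grad f y 0 j)).
  apply/funext => s; rewrite /sampling_noise mxE [X in X + _]mxE [X in _ + X]mxE.
  congr (_ * _ + _ * _); last by rewrite !mxE.
  by rewrite mxE; apply: eq_bigr => i _; rewrite mxE [X in _ * (_ + X)]mxE.
rewrite -[X in has_mean _ _ X]addr0 -[X in has_mean _ _ (X + _)](mulr0 (1 - a))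
  -[X in has_mean _ _ (_ + X)](mulr0 a).
apply: has_meanD; apply: has_meanZ; last exact/centered/mean_grad.
have z : \sum_(i < d) (0 : R) = 0 by rewrite big1.
rewrite -[X in has_mean _ _ X]z.
apply: has_mean_sum => i; rewrite -(mulr0 (u 0 i)).
exact/has_meanZ/centered/mean_hess.
Qed.

Let measurable_hess_diff y (u : 'rV[R]_d) :
  measurable_rV (fun s => u *m (hess (psi s) y - hess f y)).
Proof.
apply: measurable_rV_mulmx; first exact: measurable_rV_cst.
move=> i j; under [X in measurable_fun _ X]eq_fun do rewrite mxE [X in _ + X]mxE.
exact: (measurable_funB (has_mean_measurable (mean_hess y i j))).
Qed.

(** Normalizing [u] first lets its length leave the expectation of a function known to be
    measurable; the spectral norm then enters by pointwise comparison alone. *)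
Lemma hess_noise_moment y u :
  ('E_D[fun s => (enorm (u *m (hess (psi s) y - hess f y)) ^+ 2)%R]
     <= (enorm u ^+ 2 * sigma_h ^+ 2)%:E)%E.
Proof.
pose v := (enorm u)^-1 *: u.
have uE : u = enorm u *: v.
  have [u0|u0] := eqVneq (enorm u) 0.
    by rewrite /v u0 scale0r; exact: enorm_eq0.
  by rewrite scalerA divff // scale1r.
have -> : (fun s => enorm (u *m (hess (psi s) y - hess f y)) ^+ 2)
  = (fun s => enorm u ^+ 2 * enorm (v *m (hess (psi s) y - hess f y)) ^+ 2).
  apply/funext => s; rewrite {1}uE -scalemxAl enormZ exprMn.
  by rewrite ger0_norm ?enorm_ge0.
rewrite ge0_expectationZ ?sqr_ge0 //; last first.
- exact/measurable_funX/measurable_enorm/measurable_hess_diff.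
- by move=> s; apply: sqr_ge0.
rewrite [leRHS]EFinM lee_wpmul2l ?lee_fin ?sqr_ge0 //.
apply: le_trans (var_hess y).
apply: ge0_le_expectation => s; first exact: sqr_ge0.
rewrite ler_pXn2r ?nnegrE ?enorm_ge0 ?spectral_norm_ge0 //.
exact/spectral_norm_ub/enorm_normalize_le1.
Qed.

Lemma noise_second_moment a y u : 0 <= a <= 1 ->
  ('E_D[fun s => (enorm (sampling_noise a (psi s) f y u) ^+ 2)%R]
     <= (2 * (enorm u ^+ 2 * sigma_h ^+ 2) + 2 * (a ^+ 2 * sigma_g ^+ 2))%:E)%E.
Proof.
move=> /andP[a0 a1].
have mh := measurable_funX 2 (measurable_enorm (measurable_hess_diff y u)).
have mg : measurable_fun setT (fun s => enorm (grad (psi s) y - grad f y) ^+ 2).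
  apply/measurable_funX/measurable_enorm/measurable_rVB; last first.
    exact: measurable_rV_cst.
  by move=> j; exact: has_mean_measurable (mean_grad y 0 j).
apply: (@le_trans _ _ ('E_D[fun s =>
   (2 * enorm (u *m (hess (psi s) y - hess f y)) ^+ 2
   + 2 * a ^+ 2 * enorm (grad (psi s) y - grad f y) ^+ 2)%R])%E).
  apply: ge0_le_expectation => s; first exact: sqr_ge0.
  apply: le_trans (enorm_sqrD_le _ _) _; rewrite !enormZ !exprMn.
  rewrite !real_normK ?num_real //; apply: lerD; last by rewrite mulrA.
  rewrite ler_wpM2l // ler_piMl ?sqr_ge0 // expr_le1 ?subr_ge0 //.
  by rewrite gerBl.
rewrite ge0_expectationD; first last.
- exact: measurable_funM.
- exact: measurable_funM.
- by move=> s; rewrite mulr_ge0 ?sqr_ge0 // mulr_ge0 ?sqr_ge0.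
- by move=> s; rewrite mulr_ge0 ?sqr_ge0.
rewrite !ge0_expectationZ ?mulr_ge0 ?sqr_ge0 //; try by move=> s; apply: sqr_ge0.
rewrite [leRHS]EFinD; apply: leeD.
  by rewrite [leRHS]EFinM lee_wpmul2l // hess_noise_moment.
by rewrite mulrA [leRHS]EFinM lee_wpmul2l ?lee_fin ?mulr_ge0 ?sqr_ge0.
Qed.

End ClientNoise.

Section SamplingNoiseMeasurability.
Context {R : realType} {d : nat}.
Context {dX dT : measure_display} {X : measurableType dX} {T : measurableType dT}.
Variables (psi : X -> 'rV[R]_d -> R) (f : 'rV[R]_d -> R).
Variables (g : T -> X) (Y U : T -> 'rV[R]_d) (a : R).
Hypothesis dpsi : forall s, twice_differentiable (psi s).
Hypothesis df : twice_differentiable f.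
Hypothesis mpsi : forall y, measurable_rV (fun s => grad (psi s) y).
Hypotheses (mg : measurable_fun setT g) (mY : measurable_rV Y) (mU : measurable_rV U).

Lemma measurable_sampling_noise :
  measurable_rV (fun w => sampling_noise a (psi (g w)) f (Y w) (U w)).
Proof.
have dpsi2 s y : differentiable (grad (psi s)) y by case: (dpsi s).
have df2 (s : X) y : differentiable (grad f) y by case: df.
have mf (y : 'rV[R]_d) : measurable_rV (fun _ : X => grad f y).
  exact: measurable_rV_cst.
apply: measurable_rVD; apply: measurable_rVZ => //.
  apply: measurable_rV_mulmx => // i j.
  under [X in measurable_fun _ X]eq_fun do rewrite mxE [X in _ + X]mxE.
  apply: measurable_funB; first exact: (measurable_hess dpsi2 mpsi).
  exact: (measurable_hess df2 mf mg mY).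
apply: measurable_rVB; first exact: (measurable_grad dpsi2 mpsi).
exact: (measurable_grad df2 mf mg mY).
Qed.

End SamplingNoiseMeasurability.

(** * Sigma-algebras generated by random variables *)

Section GeneratedSigmaAlgebras.
Context {dO : measure_display} {Omega : measurableType dO}.

Lemma measurable_fun_generatedP (dY : measure_display) (Y : measurableType dY)
    (G : set (set Omega)) (X : Omega -> Y) :
  measurable_fun [set: g_sigma_algebraType G] X <-> sigma_of X `<=` <<s G>>.
Proof.
split=> [mX _ [B mB <-]|GX _ B mB]; first exact: mX.
by apply: GX; exists B.
Qed.

Lemma measurable_fun_coarser (dY : measure_display) (Y : measurableType dY)
    (G H : set (set Omega)) (X : Omega -> Y) :
  G `<=` <<s H>> -> measurable_fun [set: g_sigma_algebraType G] X ->
  measurable_fun [set: g_sigma_algebraType H] X.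
Proof.
move=> GH mX _ B mB; have := mX measurableT B mB.
apply: smallest_sub => //.
exact: (@smallest_sigma_algebra _ setT).
Qed.

Lemma generated_sub_measurable (G : set (set Omega)) :
  G `<=` measurable -> <<s G>> `<=` @measurable _ Omega.
Proof. by apply: smallest_sub; exact: sigma_algebra_measurable. Qed.

Lemma measurable_fun_generated (dY : measure_display) (Y : measurableType dY)
    (G : set (set Omega)) (X : Omega -> Y) :
  G `<=` measurable -> measurable_fun [set: g_sigma_algebraType G] X ->
  measurable_fun [set: Omega] X.
Proof.
move=> GO mX _ B mB; have := mX measurableT B mB.
exact: generated_sub_measurable.
Qed.

Lemma sigma_of_setT (T : Type) (dY : measure_display) (Y : measurableType dY)
  (X : T -> Y) : sigma_of X setT.
Proof. by exists setT => //; rewrite preimage_setT setTI. Qed.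

Lemma sigma_of_setI (T : Type) (dY : measure_display) (Y : measurableType dY)
  (X : T -> Y) : setI_closed (sigma_of X).
Proof.
move=> _ _ [A mA <-] [B mB <-]; exists (A `&` B); first exact: measurableI.
by rewrite !setTI.
Qed.

Lemma sigma_of_measurable (dY : measure_display) (Y : measurableType dY)
  (X : Omega -> Y) : measurable_fun setT X -> sigma_of X `<=` measurable.
Proof. by move=> mX _ [B mB <-]; exact: mX. Qed.

End GeneratedSigmaAlgebras.

(** * Averaging over the random output index *)

Section RandomIndex.
Context {R : realType} {dO : measure_display} {Omega : measurableType dO}.
Variables (P : probability Omega R) (tau : {RV P >-> nat}).
Variables (G : set (set Omega)) (T : nat) (p : nat -> R) (h : nat -> Omega -> R).
Hypothesis G_meas : G `<=` measurable.
Hypothesis tau_indep : independent P (sigma_of tau) <<s G>>.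
Hypothesis tau_law : forall t, (t < T)%N -> P (tau @^-1` [set t]) = (p t)%:E.
Hypothesis p_sum : \sum_(t < T) p t = 1.
Hypothesis h_ge0 : forall t w, 0 <= h t w.
Hypothesis h_meas : forall t, measurable_fun [set: Omega] (h t).
Hypothesis h_adapted : forall t, (t < T)%N ->
  measurable_fun [set: g_sigma_algebraType G] (h t).

Let measurable_level (A : set nat) : measurable (tau @^-1` A).
Proof. by rewrite -[X in measurable X]setTI; exact: measurable_funP. Qed.

Lemma random_index_lt : P (tau @^-1` [set k | (T <= k)%N]) = 0%E.
Proof.
have E : P (tau @^-1` [set k | (k < T)%N]) = 1%E.
  have -> : tau @^-1` [set k | (k < T)%N]
      = \big[setU/set0]_(t < T) (tau @^-1` [set (t : nat)]).
    rewrite -(bigcup_mkord T (fun t => tau @^-1` [set t])); apply/seteqP; split => w /=.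
      by move=> tT; exists (tau w).
    by move=> [t /= tT ->].
  transitivity (\sum_(t < T) P (tau @^-1` [set (t : nat)]))%E.
    apply: (measure_bigsetU P (F := fun t => tau @^-1` [set t])) => //.
    exact: trivIset_preimage1.
  by rewrite (eq_bigr (fun t : 'I_T => (p t)%:E)) ?sumEFin ?p_sum // => t _; exact: tau_law.
have -> : tau @^-1` [set k | (T <= k)%N] = ~` (tau @^-1` [set k | (k < T)%N]).
  apply/seteqP; split => w /=; first by rewrite leqNgt => /negP.
  by move=> /negP; rewrite -leqNgt.
by rewrite probability_setC // E subee.
Qed.

Lemma measurable_random_index : measurable_fun setT (fun w => h (tau w) w).
Proof.
move=> _ B mB; rewrite setTI.
have -> : (fun w => h (tau w) w) @^-1` B =
    \bigcup_(t : nat) (tau @^-1` [set t] `&` h t @^-1` B).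
  by apply/seteqP; split => w /= => [hB|[t _ [<-]]//]; exists (tau w).
apply: bigcupT_measurable => t; apply: measurableI => //.
by rewrite -[X in measurable X]setTI; exact: h_meas.
Qed.

Lemma expectation_random_index :
  ('E_P[fun w => h (tau w) w] <= 'E_P[fun w => (\sum_(t < T) p t * h t w)%R])%E.
Proof.
(* [tau] may reach [T] or more on a null event, and adaptedness of [h t] is known only for [t < T].
   The function [k] agrees with [h] below [T] and vanishes from [T] on, so it can be frozen for
   every value of the index. *)
pose k (j : nat) w := \sum_(t < T) (j == t)%:R * h t w.
have k_ge0 j w : 0 <= k j w by apply: sumr_ge0 => t _; rewrite mulr_ge0.
have kE j w : (j < T)%N -> k j w = h j w.
  move=> jT; rewrite /k (bigD1 (Ordinal jT)) //= eqxx mul1r big1 ?addr0 //.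
  by move=> t /negbTE; rewrite -val_eqE /= eq_sym => ->; rewrite mul0r.
have eq_meas (t : nat) : measurable_fun setT (fun j : nat => (j == t)%:R : R).
  have -> : (fun j : nat => (j == t)%:R : R) = \1_[set t].
    by apply/funext => j; rewrite indicE in_set1.
  exact: measurable_indic.
have k_meas : measurable_fun [set: nat * g_sigma_algebraType G]
    (fun q => k q.1 q.2).
  apply: measurable_sum => t; apply: measurable_funM.
    exact: (measurableT_comp (eq_meas t) measurable_fst).
  exact: (measurableT_comp (h_adapted (ltn_ord t)) measurable_snd).
have -> : ('E_P[fun w => h (tau w) w] = 'E_P[fun w => k (tau w) w])%E.
  rewrite unlock; apply: ge0_ae_eq_integral => //.
  - exact/measurable_EFinP/measurable_random_index.
  - apply/measurable_EFinP; apply: measurable_sum => t; apply: measurable_funM => //.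
    exact: (measurableT_comp (eq_meas t)).
  - by move=> w _; rewrite lee_fin.
  - by move=> w _; rewrite lee_fin.
  - exists (tau @^-1` [set j | (T <= j)%N]); split => //.
      exact: random_index_lt.
    move=> w /= hw; rewrite leqNgt; apply/negP => tT; apply: hw => _.
    by rewrite kE.
apply: (expectation_freeze_le (D := distribution P tau) _
  (generated_sub_measurable G_meas) tau_indep) => //.
move=> w; suff [] : mean_le (distribution P tau) (k ^~ w) (\sum_(t < T) p t * h t w) by [].
apply: mean_le_sum => t; rewrite mulrC.
under eq_fun do rewrite mulrC.
apply: mean_leZ => //; split => //.
have -> : (fun j : nat => (j == t)%:R : R) = \1_[set (t : nat)].
  by apply/funext => j; rewrite indicE in_set1.
by rewrite expectation_indic // -tau_law.
Qed.

End RandomIndex.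

(** * Convergence *)

Lemma telescope_step (R : realDomainType) (a b c m A B K d1 d2 : R) :
  a + c <= b + d1 + d2 -> b - m + A <= K + B ->
  a - m + (A + c) <= K + (B + (d1 + d2)).
Proof. by lra. Qed.

Fixpoint discounted_sum (R : realType) (d : nat) (eta : nat -> R)
    (M : nat -> 'rV[R]_d) (t : nat) : 'rV[R]_d :=
  if t is t'.+1 then (1 - eta t') *: discounted_sum eta M t' + M t' else 0.

Section Algorithm.
Context {R : realType} {n d : nat} {dO : measure_display}.
Context {Omega : measurableType dO} (P : probability Omega R).
Context {dX : 'I_n -> measure_display} {X : forall i, measurableType (dX i)}.
Variable D : forall i, probability (X i) R.
Context {dZ : nat -> 'I_n -> measure_display}.
Context {Z : forall t i, measurableType (dZ t i)}.
Variables (xi : forall (t : nat) (i : 'I_n), {RV P >-> X i}).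
Variables (zeta : forall (t : nat) (i : 'I_n), {RV P >-> Z t i}).
Variables (f : 'I_n -> 'rV[R]_d -> R) (phi : forall i, X i -> 'rV[R]_d -> R).
Variable c : forall (t : nat) (i : 'I_n), Z t i -> 'rV[R]_d -> 'rV[R]_d.
Variables (alpha L sigma_g sigma_h gamma0 : R) (Li Lhi : 'I_n -> R).
Variables (x0 : 'rV[R]_d) (g0 v0 : 'I_n -> 'rV[R]_d).

Let F := fun x => raverage (fun i => f i x).
Let gamma := fun t => gamma0 * decay R t.
Let eta := fun t => decay R t.
Let state := fun t (w : Omega) =>
  ef21_hm gamma eta x0 g0 v0 (fun s i => phi (xi s i w))
    (fun s i => c (zeta s i w)) t.
Let x := fun t w => st_x (state t w).
Let compressor_input := fun t i (w : Omega) =>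
  st_v (state t.+1 w) i - st_g (state t w) i : borel_rV R d.
Let D_sigma := sigma_g + gamma0 * sigma_h.

Hypothesis n_gt0 : (0 < n)%N.
Hypothesis gamma0_gt0 : 0 < gamma0.
Hypothesis df : forall i, twice_differentiable (f i).
Hypothesis dphi : forall i (s : X i), twice_differentiable (phi s).
Hypothesis xi_law :
  forall t i A, measurable A -> distribution P (xi t.+1 i) A = D i A.
Hypothesis xi_indep : forall t, mutually_independent P (fun o : option 'I_n =>
  if o is Some i then sigma_of (xi t.+1 i) else history xi zeta t).
Hypothesis c_meas : forall t i, random_map_measurable (@c t.+1 i).
Hypothesis zeta_indep : forall t i, independent P (sigma_of (zeta t.+1 i))
  <<s history xi zeta t `|` sigma_of (compressor_input t i) >>.
Hypothesis alpha01 : 0 < alpha <= 1.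
Hypothesis c_contr :
  forall t i, contractive P alpha (fun w => c (zeta t.+1 i w)).
Hypothesis F_lb : has_lbound (range F).
Hypothesis Li_gt0 : forall i, 0 < Li i.
Hypothesis f_lip : forall i, lipschitz_grad (Li i) (f i).
Hypothesis L_gt0 : 0 < L.
Hypothesis F_lip : lipschitz_grad L F.
Hypothesis Lhi_gt0 : forall i, 0 < Lhi i.
Hypothesis f_hlip : forall i, lipschitz_hess (Lhi i) (f i).
Hypothesis sigma_g_ge0 : 0 <= sigma_g.
Hypothesis sigma_h_ge0 : 0 <= sigma_h.
Hypothesis mean_grad : forall i y,
  has_mean_mx (D i) (fun s => grad (@phi i s) y) (grad (f i) y).
Hypothesis var_grad : forall i y,
  ('E_(D i)[fun s => (enorm (grad (@phi i s) y - grad (f i) y) ^+ 2)%R]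
     <= (sigma_g ^+ 2)%:E)%E.
Hypothesis mean_hess : forall i y,
  has_mean_mx (D i) (fun s => hess (@phi i s) y) (hess (f i) y).
Hypothesis var_hess : forall i y,
  ('E_(D i)[fun s => (spectral_norm (hess (@phi i s) y - hess (f i) y) ^+ 2)%R]
     <= (sigma_h ^+ 2)%:E)%E.

Let g t i w := st_g (state t w) i.
Let v t i w := st_v (state t w) i.
Let e t i w := v t i w - grad (f i) (x t w).
Let M t i w := sampling_noise (eta t) (phi (xi t.+1 i w)) (f i)
  (x t.+1 w) (x t.+1 w - x t w).
Let W t i w := discounted_sum eta (fun s => M s i w) t.

Let gamma_ge0 t : 0 <= gamma t.
Proof. by rewrite mulr_ge0 ?decay_ge0 // ltW. Qed.

Let eta01 t : 0 <= eta t <= 1.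
Proof. by rewrite decay_ge0 decay_le1. Qed.

Let mphi i y : measurable_rV (fun s => grad (@phi i s) y).
Proof. by move=> j; exact: has_mean_measurable (mean_grad i y 0 j). Qed.

Let D_sigma_ge0 : 0 <= D_sigma.
Proof. by rewrite addr_ge0 // mulr_ge0 // ltW. Qed.

(** * Adaptedness of the trajectory *)

Section Adapted.
Variables (G : set (set Omega)) (t : nat).
Hypothesis G_xi : forall s i, (1 <= s <= t)%N -> sigma_of (xi s i) `<=` <<s G>>.
Local Notation adapted := (@measurable_rV R d _ (g_sigma_algebraType G)).

(** The iterate is predictable: the step to [x s.+1] is made before the samples of time [s.+1] are
    drawn, so the point where they are evaluated can be frozen. *)
Lemma next_iterate_adapted s : adapted (x s) -> (forall i, adapted (g s i)) ->
  adapted (x s.+1).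
Proof.
move=> mx mg; apply: measurable_rVB => //.
by apply/measurable_rVZ/measurable_normalize/measurable_average.
Qed.

Lemma noise_adapted s i : (s < t)%N -> adapted (x s) -> adapted (x s.+1) ->
  adapted (M s i).
Proof.
move=> st mx mx'; apply: measurable_sampling_noise => //.
- by apply/measurable_fun_generatedP; apply: G_xi.
- exact: measurable_rVB.
Qed.

Hypothesis G_zeta :
  forall s i, (1 <= s <= t)%N -> sigma_of (zeta s i) `<=` <<s G>>.

Lemma estimator_adapted s i : (s < t)%N ->
  adapted (x s) -> adapted (x s.+1) -> adapted (v s i) -> adapted (v s.+1 i).
Proof.
move=> st mx mx' mv; rewrite /v /=.
have mxi : measurable_fun [set: g_sigma_algebraType G] (xi s.+1 i).
  by apply/measurable_fun_generatedP; apply: G_xi.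
have dphi2 (z : X i) y : differentiable (grad (phi z)) y by case: (dphi z).
apply: measurable_rVD; apply: measurable_rVZ => //.
  apply: measurable_rVD => //; apply: measurable_rV_mulmx.
    exact: measurable_rVB.
  by move=> j k; exact: (measurable_hess dphi2 (@mphi i)).
exact: (measurable_grad dphi2 (@mphi i)).
Qed.

Lemma state_adapted s : (s <= t)%N ->
  [/\ adapted (x s), forall i, adapted (g s i) & forall i, adapted (v s i)].
Proof.
elim: s => [_|s IH st].
  by split=> *; exact: measurable_rV_cst.
have [mx mg mv] := IH (ltnW st).
have mx' := next_iterate_adapted mx mg.
have mv' i : adapted (v s.+1 i) by exact: estimator_adapted.
split => // i; rewrite /g /=; apply: measurable_rVD; first exact: mg.
have mzeta : measurable_fun [set: g_sigma_algebraType G] (zeta s.+1 i).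
  by apply/measurable_fun_generatedP; apply: G_zeta.
have mI : measurable_fun [set: g_sigma_algebraType G] (compressor_input s i).
  exact: (measurable_fun_borel_rV (measurable_rVB (mv' i) (mg i))).
move=> j; apply: (measurableT_comp (measurable_rV_borel j)).
exact: (measurableT_comp (@c_meas s i) (measurable_fun_pair mzeta mI)).
Qed.

Lemma discounted_noise_adapted s i : (s <= t)%N -> adapted (W s i).
Proof.
elim: s => [_|s IH st]; first exact: measurable_rV_cst.
have [mx mg _] := state_adapted (ltnW st).
apply: measurable_rVD; first by apply: measurable_rVZ => //; exact: IH (ltnW st).
by apply: noise_adapted => //; exact: next_iterate_adapted.
Qed.

End Adapted.

Local Notation adapted G := (@measurable_rV R d _ (g_sigma_algebraType G)).

Lemma history_xi t s i : (1 <= s <= t)%N ->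
  sigma_of (xi s i) `<=` <<s history xi zeta t>>.
Proof.
move=> st A A_xi; do 2 apply: sub_sigma_algebra.
by exists s => //; exists i => //; left.
Qed.

Lemma history_zeta t s i : (1 <= s <= t)%N ->
  sigma_of (zeta s i) `<=` <<s history xi zeta t>>.
Proof.
move=> st A A_xi; do 2 apply: sub_sigma_algebra.
by exists s => //; exists i => //; right.
Qed.

Lemma history_measurable t : history xi zeta t `<=` measurable.
Proof.
apply: generated_sub_measurable => A [s _ [i _ [|]]];
  by apply: sigma_of_measurable.
Qed.

Lemma history_adapted t s : (s <= t)%N ->
  [/\ adapted (history xi zeta t) (x s),
      forall i, adapted (history xi zeta t) (g s i) &
      forall i, adapted (history xi zeta t) (v s i)].
Proof.
by apply: state_adapted => [? i|? i]; [exact: history_xi|exact: history_zeta].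
Qed.

Lemma history_adapted_next t : adapted (history xi zeta t) (x t.+1).
Proof.
by have [mx mg _] := history_adapted (leqnn t); exact: next_iterate_adapted.
Qed.

Let mx t : measurable_rV (x t).
Proof.
have [mx _ _] := history_adapted (leqnn t).
by move=> j; exact: (measurable_fun_generated (@history_measurable t) (mx j)).
Qed.

Let mg t i : measurable_rV (g t i).
Proof.
have [_ mg _] := history_adapted (leqnn t).
by move=> j; exact: (measurable_fun_generated (@history_measurable t) (mg i j)).
Qed.

Let mv t i : measurable_rV (v t i).
Proof.
have [_ _ mv] := history_adapted (leqnn t).
by move=> j; exact: (measurable_fun_generated (@history_measurable t) (mv i j)).
Qed.

Lemma discounted_noise_history t i : adapted (history xi zeta t) (W t i).
Proof.
by apply: (@discounted_noise_adapted _ t) => // s j;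
  [exact: history_xi|exact: history_zeta].
Qed.

Let mW t i : measurable_rV (W t i).
Proof.
move=> j; apply: (measurable_fun_generated (@history_measurable t)).
exact: discounted_noise_history.
Qed.

Let mM t i : measurable_rV (M t i).
Proof. by apply: measurable_sampling_noise => //; exact: measurable_rVB. Qed.

Let source t (o : option 'I_n) : set (set Omega) :=
  if o is Some i then sigma_of (xi t.+1 i) else history xi zeta t.

Let others t (k : 'I_n) := \bigcup_(o in [set o | o != Some k]) source t o.

Let source_measurable t o : source t o `<=` measurable.
Proof.
by case: o => [i|]; [exact: sigma_of_measurable|exact: history_measurable].
Qed.

Let others_measurable t k : others t k `<=` measurable.
Proof. by move=> A [j _]; exact: source_measurable. Qed.

Lemma client_independent t k :
  independent P (sigma_of (xi t.+1 k)) <<s others t k>>.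
Proof.
apply: (@mutually_independent_complement _ _ _ P _ (source t) (Some k)
  (@source_measurable t) _ _ (@xi_indep t)).
  case=> [i|]; first exact: sigma_of_setT.
  exact: (@measurableT _ (g_sigma_algebraType _)).
case=> [i|]; first exact: sigma_of_setI.
by move=> A B; exact: (@measurableI _ (g_sigma_algebraType _)).
Qed.

Let noise_var t := 2 * (eta t ^+ 2 * D_sigma ^+ 2).

Let noise_var_ge0 t : 0 <= noise_var t.
Proof. by rewrite mulr_ge0 // mulr_ge0 ?sqr_ge0. Qed.

Lemma client_noise_moment t i w :
  ('E_(D i)[fun s => (enorm (sampling_noise (eta t) (@phi i s) (f i)
      (x t.+1 w) (x t.+1 w - x t w)) ^+ 2)%R] <= (noise_var t)%:E)%E.
Proof.
apply: le_trans (noise_second_moment (mean_grad i) (var_grad i) (mean_hess i)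
  (var_hess i) _ _ (eta01 t)) _.
rewrite lee_fin /noise_var -mulrDr ler_wpM2l //.
have ul : enorm (x t.+1 w - x t w) <= gamma t.
  exact: (step_length_le gamma_ge0 t (state t w)).
have u2 : enorm (x t.+1 w - x t w) ^+ 2 <= gamma t ^+ 2.
  by rewrite ler_pXn2r ?nnegrE ?enorm_ge0.
apply: (@le_trans _ _ (gamma t ^+ 2 * sigma_h ^+ 2 + eta t ^+ 2 * sigma_g ^+ 2)).
  by rewrite lerD2r ler_wpM2r ?sqr_ge0.
(* The step length is gamma0 eta, so both variances share the factor eta^2; what remains is
   sigma_g^2 + (gamma0 sigma_h)^2 <= D_sigma^2. *)
rewrite /gamma -/(eta t) exprMn (mulrC (gamma0 ^+ 2)) -mulrA -exprMn -mulrDr.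
rewrite ler_wpM2l ?sqr_ge0 // /D_sigma.
have := mulr_ge0 sigma_g_ge0 (mulr_ge0 (ltW gamma0_gt0) sigma_h_ge0).
set a := gamma0 * sigma_h => h; rewrite !expr2; lra.
Qed.

(* The clients are added one at a time, each being independent of the past and
   of the other clients. *)
Lemma partial_noise_moment t (a : Omega -> 'rV[R]_d) (b : 'I_n -> R)
    (s : seq 'I_n) : uniq s -> adapted (history xi zeta t) a ->
  ('E_P[fun w => (enorm (a w + \sum_(i <- s) b i *: M t i w) ^+ 2)%R]
   <= 'E_P[fun w => (enorm (a w) ^+ 2)%R]
      + (noise_var t * \sum_(i <- s) b i ^+ 2)%:E)%E.
Proof.
move=> + ma; elim: s => [_|k s IH /= /andP[ks us]].
  rewrite big_nil mulr0 adde0.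
  by under [X in ('E_P[X] <= _)%E]eq_fun do rewrite big_nil addr0.
rewrite big_cons mulrDr EFinD addeCA; apply: le_trans (leeD2l _ (IH us)).
pose A w := a w + \sum_(i <- s) b i *: M t i w.
have history_others : history xi zeta t `<=` <<s others t k>>.
  by move=> B HB; apply: sub_sigma_algebra; exists None.
have adaptedW (Y : Omega -> 'rV[R]_d) :
    adapted (history xi zeta t) Y -> adapted (others t k) Y.
  by move=> mY j; exact: (measurable_fun_coarser history_others (mY j)).
have [hx _ _] := history_adapted (leqnn t).
have ox : adapted (others t k) (x t) := adaptedW _ hx.
have ox' : adapted (others t k) (x t.+1) := adaptedW _ (@history_adapted_next t).
have oM i : i != k -> adapted (others t k) (M t i).
  move=> ik; apply: measurable_sampling_noise => //; last exact: measurable_rVB.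
  apply/measurable_fun_generatedP => B HB; apply: sub_sigma_algebra.
  by exists (Some i).
have oA : adapted (others t k) A.
  apply: measurable_rVD; first exact: adaptedW.
  elim: (s) ks => [_|i r IHr].
    by under eq_fun do rewrite big_nil; exact: measurable_rV_cst.
  rewrite in_cons negb_or => /andP[ik /IHr mr].
  under eq_fun do rewrite big_cons; apply: measurable_rVD => //.
  by apply: measurable_rVZ => //; apply: oM; rewrite eq_sym.
have o2 (Y : Omega -> 'rV[R]_d) : adapted (others t k) Y ->
    measurable_rV (fun p : X k * g_sigma_algebraType (others t k) => Y p.2).
  by move=> mY j; exact: (measurableT_comp (mY j) measurable_snd).
have o2x := o2 _ ox; have o2x' := o2 _ ox'.
have mA : measurable_rV A.
  by move=> j; exact: (measurable_fun_generated (@others_measurable t k) (oA j)).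
have -> : (fun w => enorm (a w + \sum_(i <- k :: s) b i *: M t i w) ^+ 2)
    = (fun w => enorm (A w + b k *: M t k w) ^+ 2).
  by apply/funext => w; rewrite big_cons /A addrCA addrC.
apply: (@le_trans _ _ ('E_P[fun w => (enorm (A w) ^+ 2 + b k ^+ 2 * noise_var t)%R])%E).
  apply: (expectation_freeze_le (@xi_law t k)
    (generated_sub_measurable (@others_measurable t k))
    (@client_independent t k)
    (h := fun z w => enorm (A w + b k *: sampling_noise (eta t) (@phi k z) (f k)
       (x t.+1 w) (x t.+1 w - x t w)) ^+ 2)).
  - by move=> z w; apply: sqr_ge0.
  - apply/measurable_funX/measurable_enorm/measurable_rVD.
      exact: o2.
    apply: measurable_rVZ => //.
    have m1 : measurable_fun [set: X k * g_sigma_algebraType (others t k)] fst.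
      exact: measurable_fst.
    have H := measurable_sampling_noise (eta t) (@dphi k) (df k) (@mphi k)
      m1 o2x' (measurable_rVB o2x' o2x).
    exact: H.
  - move=> w; apply: centered_shift_sqr; last exact: client_noise_moment.
    by move=> j; apply: noise_centered; [exact: mean_grad|exact: mean_hess].
rewrite ge0_expectationD ?expectation_const 1?addeC 1?mulrC //.
- by move=> w; apply: sqr_ge0.
- by move=> w; rewrite mulr_ge0 ?sqr_ge0.
- exact/measurable_funX/measurable_enorm.
Qed.

(** General weights serve two purposes: an indicator picks out a single client, and the constant 1/n
    gives the average over clients. *)
Let noise_sum (b : 'I_n -> R) t w := \sum_i b i *: W t i w.

Lemma discounted_noise_moment (b : 'I_n -> R) t :
  ('E_P[fun w => (enorm (noise_sum b t w) ^+ 2)%R]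
   <= (decay_weight R t * (2 * D_sigma ^+ 2 * \sum_i b i ^+ 2))%:E)%E.
Proof.
have mS s : adapted (history xi zeta s) (noise_sum b s).
  apply: measurable_rV_sum => i; apply: measurable_rVZ => //.
  exact: discounted_noise_history.
elim: t => [|t IH].
  rewrite mul0r; under [X in ('E_P[X] <= _)%E]eq_fun do
    (rewrite /noise_sum big1 => [|i _]; [rewrite enorm0 expr0n|by rewrite scaler0]).
  by rewrite expectation_const.
have -> : (fun w => enorm (noise_sum b t.+1 w) ^+ 2) = (fun w =>
    enorm ((1 - eta t) *: noise_sum b t w + \sum_i b i *: M t i w) ^+ 2).
  apply/funext => w; congr (enorm _ ^+ 2).
  rewrite /noise_sum scaler_sumr -big_split /=; apply: eq_bigr => i _.
  by rewrite scalerDr !scalerA mulrC.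
apply: le_trans (partial_noise_moment _ (index_enum_uniq _) _) _.
  exact: measurable_rVZ.
have -> : (fun w => enorm ((1 - eta t) *: noise_sum b t w) ^+ 2)
    = (fun w => (1 - eta t) ^+ 2 * enorm (noise_sum b t w) ^+ 2).
  by apply/funext => w; rewrite enormZ exprMn real_normK ?num_real.
rewrite ge0_expectationZ ?sqr_ge0 //; last 2 first.
- by move=> w; apply: sqr_ge0.
- apply/measurable_funX/measurable_enorm => j.
  exact: (measurable_fun_generated (@history_measurable t) (mS t j)).
have e0 : 0 <= (1 - eta t) ^+ 2 by exact: sqr_ge0.
apply: le_trans (leeD2r _ (lee_wpmul2l _ IH)) _; first by rewrite lee_fin.
rewrite -EFinM -EFinD lee_fin /noise_var /=.
set K := decay_weight R t; set B := \sum_i b i ^+ 2.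
have B0 : 0 <= B by apply: sumr_ge0 => i _; apply: sqr_ge0.
have K0 : 0 <= K by exact: decay_weight_ge0.
have /andP[h0 h1] := eta01 t.
have -> : (1 - eta t) ^+ 2 * (K * (2 * D_sigma ^+ 2 * B))
    + 2 * (eta t ^+ 2 * D_sigma ^+ 2) * B
  = ((1 - eta t) ^+ 2 * K + eta t ^+ 2) * (2 * D_sigma ^+ 2 * B) by ring.
(* The exact variance recursion has discount (1 - eta)^2; it is relaxed to 1 - eta to match
   [decay_weight]. *)
rewrite ler_wpM2r ?mulr_ge0 ?sqr_ge0 // lerD2r ler_wpM2r //.
by rewrite expr2 ler_piMl ?subr_ge0 // gerBl.
Qed.

Lemma noise_mean_le t i : ('E_P[fun w => enorm (M t i w)] <= (2 * eta t * D_sigma)%:E)%E.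
Proof.
have /andP[h0 h1] := eta01 t.
have h2 : 0 <= 2 * eta t * D_sigma by rewrite !mulr_ge0.
apply: expectation_le_of_sqr => //; first by move=> w; exact: enorm_ge0.
  exact: measurable_enorm.
have := @partial_noise_moment t (fun=> 0) (fun=> 1) [:: i] isT (measurable_rV_cst _).
rewrite big_seq1 expr1n mulr1 enorm0.
under [X in ('E_P[X] <= _)%E -> _]eq_fun do rewrite big_seq1 scale1r add0r.
rewrite expr0n expectation_const add0e => H; apply: le_trans H _.
rewrite lee_fin /noise_var !exprMn mulrA ler_wpM2r ?sqr_ge0 //.
(* The factor sqrt 2 of the standard deviation is rounded up to 2. *)
by rewrite ler_wpM2r ?sqr_ge0 // expr2 ler_peMl // ler1n.
Qed.

Lemma discounted_noise_mean_le t i :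
  ('E_P[fun w => enorm (W t i w)] <= (2 * D_sigma)%:E)%E.
Proof.
apply: expectation_le_of_sqr; [by rewrite mulr_ge0| | |].
- by move=> w; exact: enorm_ge0.
- exact: measurable_enorm.
have := discounted_noise_moment (fun j => (j == i)%:R) t.
have E w : noise_sum (fun j => (j == i)%:R) t w = W t i w.
  rewrite /noise_sum (bigD1 i) //= eqxx scale1r big1 ?addr0 // => j /negbTE ->.
  by rewrite scale0r.
under [X in ('E_P[X] <= _)%E -> _]eq_fun do rewrite E.
move=> H; apply: le_trans H _.
rewrite lee_fin (bigD1 i) //= eqxx expr1n big1 ?addr0 => [|j /negbTE ->]; last first.
  by rewrite expr0n.
rewrite mulr1 exprMn mulrA ler_wpM2r ?sqr_ge0 // expr2.
by rewrite ler_wpM2r // decay_weight_le2.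
Qed.

Lemma average_noise_mean_le t :
  ('E_P[fun w => enorm (average (fun i => W t.+1 i w))]
     <= (2 * D_sigma * Num.sqrt (eta t.+1) / Num.sqrt n%:R)%:E)%E.
Proof.
have n0 : 0 < n%:R :> R by rewrite ltr0n.
have /andP[h0 h1] := eta01 t.+1.
apply: expectation_le_of_sqr.
- by rewrite divr_ge0 ?sqrtr_ge0 // !mulr_ge0 ?sqrtr_ge0.
- by move=> w; exact: enorm_ge0.
- by apply/measurable_enorm/measurable_average.
have := discounted_noise_moment (fun=> n%:R^-1) t.+1.
have E w : noise_sum (fun=> n%:R^-1) t.+1 w = average (fun i => W t.+1 i w).
  by rewrite /noise_sum /average scaler_sumr.
under [X in ('E_P[X] <= _)%E -> _]eq_fun do rewrite E.
move=> H; apply: le_trans H _.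
rewrite lee_fin sumr_const card_ord -[_ *+ n]mulr_natl.
(* The gain from independent clients: the squares of [n] weights 1/n add up to 1/n. *)
have -> : n%:R * n%:R^-1 ^+ 2 = n%:R^-1 :> R by field; rewrite gt_eqF.
rewrite !exprMn exprVn !sqr_sqrtr ?ler0n // mulrA ler_wpM2r ?invr_ge0 ?ler0n //.
have := ler_wpM2r (sqr_ge0 D_sigma) (decay_weight_le R t); rewrite -/(eta t.+1).
rewrite !expr2; lra.
Qed.

(** * Propagation of the compression error *)

Let r := Num.sqrt (1 - alpha).

Let r_ge0 : 0 <= r. Proof. exact: sqrtr_ge0. Qed.

Let r_sqr : r ^+ 2 = 1 - alpha.
Proof. by rewrite sqr_sqrtr // subr_ge0; case/andP: alpha01. Qed.

Let r_lt1 : r < 1.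
Proof.
rewrite -(ltr_pXn2r (n := 2)) ?nnegrE // r_sqr expr1n.
by case/andP: alpha01 => a0 _; rewrite ltrBlDr ltrDl.
Qed.

(** The compressor input involves samples of time t+1, which are not in the history at time t, so
    freezing uses the history enlarged by the input. Passing from second to first moments turns 1 -
    alpha into its square root. *)
Lemma compression_contracts t i :
  ('E_P[fun w => enorm (g t.+1 i w - v t.+1 i w)]
   <= r%:E * 'E_P[fun w => enorm (v t.+1 i w - g t i w)])%E.
Proof.
have mI : measurable_rV (fun w => v t.+1 i w - g t i w) by exact: measurable_rVB.
pose G := history xi zeta t `|` sigma_of (compressor_input t i).
have G_meas : G `<=` measurable.
  rewrite subUset; split; first exact: history_measurable.
  exact/sigma_of_measurable/measurable_fun_borel_rV.
have mIG : measurable_fun [set: g_sigma_algebraType G] (compressor_input t i).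
  by apply/measurable_fun_generatedP => B HB; apply: sub_sigma_algebra; right.
have mIGv : adapted G (fun w => v t.+1 i w - g t i w).
  by move=> j; exact: (measurableT_comp (measurable_rV_borel j) mIG).
pose h (z : Z t.+1 i) w := enorm (c z (v t.+1 i w - g t i w) - (v t.+1 i w - g t i w)).
have -> : (fun w => enorm (g t.+1 i w - v t.+1 i w))
    = (fun w => h (zeta t.+1 i w) w).
  apply/funext => w; congr enorm; rewrite /g /=.
  by rewrite opprB [RHS]addrA [in RHS](addrC (c _ _)).
rewrite -ge0_expectationZ //; last 2 first.
- by move=> w; exact: enorm_ge0.
- exact: measurable_enorm.
apply: (expectation_freeze_le (D := distribution P (zeta t.+1 i)) (G := G) _
  (generated_sub_measurable G_meas) (@zeta_indep t i) (h := h)) => //.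
- by move=> z w; exact: enorm_ge0.
- apply/measurable_enorm/measurable_rVB => j; last first.
    exact: (measurableT_comp (mIGv j) measurable_snd).
  apply: (measurableT_comp (measurable_rV_borel j)).
  apply: (measurableT_comp (@c_meas t i)
    (g := fun p : Z t.+1 i * g_sigma_algebraType G => (p.1, compressor_input t i p.2))).
  apply: measurable_fun_pair => //.
  exact: (measurableT_comp mIG measurable_snd).
- move=> w; set u := v t.+1 i w - g t i w.
  have mc : measurable_rV (fun z : Z t.+1 i => c z u - u).
    apply: measurable_rVB; last exact: measurable_rV_cst.
    move=> j; apply: (measurableT_comp (measurable_rV_borel j)).
    apply: (measurableT_comp (@c_meas t i) (g := fun z : Z t.+1 i => (z, u : borel_rV R d))).
    by apply: measurable_fun_pair => //; exact: measurable_cst.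
  apply: expectation_le_of_sqr.
  + by rewrite mulr_ge0 ?enorm_ge0.
  + by move=> z; exact: enorm_ge0.
  + exact: measurable_enorm.
  rewrite exprMn r_sqr; apply: le_trans (@c_contr t i u).
  rewrite unlock ge0_integral_distribution //.
    exact/measurable_EFinP/measurable_funX/measurable_enorm.
  by move=> z; rewrite lee_fin sqr_ge0.
Qed.

Let err0 i := enorm (v0 i - grad (f i) x0).

Let err0_ge0 i : 0 <= err0 i. Proof. exact: enorm_ge0. Qed.

(* The error of [v0] survives only at [t = 0] because [eta 0 = 1]. *)
Lemma error_minus_noise_le t i w :
  enorm (e t i w - W t i w)
  <= (t == 0)%:R * err0 i + Lhi i / 2 * gamma0 ^+ 2 * decay_weight R t.
Proof.
elim: t => [|t IH].
  by rewrite subr0 mul1r mulr0 addr0.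
have := estimator_error_step_le gamma_ge0 eta01 df f_hlip
  (fun i => ltW (Lhi_gt0 i)) (fun i => phi (xi t.+1 i w)) t IH.
move=> H; apply: le_trans H _; rewrite mul0r add0r /=.
have /andP[h0 h1] := eta01 t.
have k0 : (1 - eta t) * ((t == 0)%:R * err0 i) = 0.
  case: eqP => [->|_]; last by rewrite mul0r mulr0.
  by rewrite /eta decay0 subrr mul0r.
have -> : Lhi i / 2 * gamma t ^+ 2 = Lhi i / 2 * gamma0 ^+ 2 * eta t ^+ 2.
  by rewrite /gamma exprMn mulrA.
rewrite -addrA mulrDr k0 add0r -mulrDr mulrCA.
have l0 := ltW (Lhi_gt0 i); have gg := ltW gamma0_gt0.
rewrite ler_wpM2l ?mulr_ge0 ?divr_ge0 //.
by rewrite mulrDr lerD2l ler_piMl ?sqr_ge0 // gerBl.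
Qed.

(** The coefficient of eta in the increment of [v]. The 4 is 2 for the new noise plus 2 for the
    discounted old noise; 3/2 is 1 for accumulated Taylor remainders plus 1/2 for the new one; the
    last term is the movement of the gradient. *)
Let Q i := 4 * D_sigma + Lhi i * gamma0 ^+ 2 * (3 / 2) + Li i * gamma0.

Let Q_ge0 i : 0 <= Q i.
Proof.
have l0 := ltW (Lhi_gt0 i); have l1 := ltW (Li_gt0 i); have gg := ltW gamma0_gt0.
by rewrite !addr_ge0 ?mulr_ge0 ?sqr_ge0 ?divr_ge0.
Qed.

(** Has the form of the recursion in [sum_decay_geometric]. The initial error [err0] appears in the
    first step only, where [eta 0 = 1] discards [v0]. *)
Fixpoint compression_error_bound i t : R :=
  if t is t'.+1 then
    r * (compression_error_bound i t' + (t' == 0)%:R * err0 i + eta t' * Q i)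
  else enorm (g0 i - v0 i).

Lemma compression_error_bound_ge0 i t : 0 <= compression_error_bound i t.
Proof.
elim: t => [|t IH]; first exact: enorm_ge0.
by rewrite mulr_ge0 // !addr_ge0 // mulr_ge0 ?enorm_ge0 ?ler0n ?decay_ge0.
Qed.

Lemma increment_mean_le t i :
  ('E_P[fun w => enorm (v t.+1 i w - v t i w)]
   <= ((t == 0)%:R * err0 i + eta t * Q i)%:E)%E.
Proof.
have /andP[h0 h1] := eta01 t.
pose C0 := (t == 0)%:R * err0 i + Lhi i / 2 * gamma0 ^+ 2 * decay_weight R t.
pose C1 := Lhi i / 2 * gamma t ^+ 2 + Li i * gamma t.
have l0 := ltW (Lhi_gt0 i); have l1 := ltW (Li_gt0 i); have gg := ltW gamma0_gt0.
have C00 : 0 <= C0.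
  by rewrite addr_ge0 ?mulr_ge0 ?err0_ge0 ?ler0n ?decay_weight_ge0 ?divr_ge0.
have C10 : 0 <= C1 by rewrite addr_ge0 ?mulr_ge0 ?divr_ge0 ?sqr_ge0.
apply: (@le_trans _ _ ('E_P[fun w => (enorm (M t i w)
    + (eta t * enorm (W t i w) + (eta t * C0 + C1)))%R])%E).
  apply: ge0_le_expectation => w; first exact: enorm_ge0.
  have H := estimator_increment_step_le gamma_ge0 eta01 df f_lip f_hlip
    (fun i => ltW (Li_gt0 i)) (fun i => ltW (Lhi_gt0 i))
    (fun i => phi (xi t.+1 i w)) t (state t w) i.
  apply: le_trans H _; rewrite -addrA; apply: lerD => //.
  rewrite [leRHS]addrA -mulrDr; apply: lerD => //; apply: ler_wpM2l => //.
  have := error_minus_noise_le t i w; rewrite -/C0 => H.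
  rewrite -[X in enorm X](subrK (W t i w)) addrC.
  by apply: le_trans (ler_enormD _ _) _; rewrite lerD.
have mWe : measurable_fun setT (fun w => enorm (W t i w)) by exact: measurable_enorm.
rewrite ge0_expectationD; first last.
- by apply: measurable_funD => //; exact: measurable_funM.
- exact: measurable_enorm.
- by move=> w; rewrite !addr_ge0 ?mulr_ge0 ?enorm_ge0.
- by move=> w; exact: enorm_ge0.
rewrite ge0_expectationD; first last.
- exact: measurable_cst.
- exact: measurable_funM.
- by move=> w; rewrite addr_ge0 // mulr_ge0.
- by move=> w; rewrite mulr_ge0 ?enorm_ge0.
rewrite ge0_expectationZ //; last by move=> w; exact: enorm_ge0.
rewrite expectation_const.
apply: le_trans (leeD (noise_mean_le t i) (leeD2r _
  (lee_wpmul2l _ (discounted_noise_mean_le t i)))) _; first by rewrite lee_fin.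
rewrite -EFinM -!EFinD lee_fin.
have kw := decay_weight_le2 R t.
have kw0 := decay_weight_ge0 R t.
set kappa := decay_weight R t in C0 C00 kw kw0 *.
have k1 : eta t * ((t == 0)%:R * err0 i) = (t == 0)%:R * err0 i.
  case: eqP => [->|_]; last by rewrite mul0r mulr0.
  by rewrite /eta decay0 mul1r.
have k2 : eta t * (Lhi i / 2 * gamma0 ^+ 2 * kappa) <= eta t * (Lhi i * gamma0 ^+ 2).
  rewrite ler_wpM2l //.
  have -> : Lhi i / 2 * gamma0 ^+ 2 * kappa = Lhi i * gamma0 ^+ 2 * (kappa / 2).
    by field.
  by rewrite ler_piMr ?mulr_ge0 ?sqr_ge0 // ler_pdivrMr // mul1r.
have k3 : Lhi i / 2 * gamma t ^+ 2 <= eta t * (Lhi i * gamma0 ^+ 2 / 2).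
  have -> : Lhi i / 2 * gamma t ^+ 2 = eta t * (Lhi i * gamma0 ^+ 2 / 2 * eta t).
    by rewrite /gamma -/(eta t); field.
  by rewrite ler_wpM2l // ler_piMr ?divr_ge0 ?mulr_ge0 ?sqr_ge0.
have k4 : Li i * gamma t = eta t * (Li i * gamma0) by rewrite /gamma -/(eta t); ring.
have C0E : eta t * C0 = (t == 0)%:R * err0 i
    + eta t * (Lhi i / 2 * gamma0 ^+ 2 * kappa) by rewrite /C0 mulrDr k1.
rewrite C0E /C1 k4 /Q.
move: (D_sigma) (eta t) (err0 i) k2 k3 => S' E' e' k2' k3'.
lra.
Qed.

Lemma compression_error_le t i :
  ('E_P[fun w => enorm (g t i w - v t i w)] <= (compression_error_bound i t)%:E)%E.
Proof.
elim: t => [|t IH].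
  suff -> : ('E_P[fun w => enorm (g 0 i w - v 0 i w)]
      = (enorm (g0 i - v0 i))%:E)%E by [].
  exact: (expectation_const P (enorm (g0 i - v0 i))).
apply: le_trans (compression_contracts t i) _.
rewrite /= EFinM lee_wpmul2l ?lee_fin //.
apply: (@le_trans _ _ ('E_P[fun w => (enorm (g t i w - v t i w)
   + enorm (v t.+1 i w - v t i w))%R])%E).
  apply: ge0_le_expectation => w; first exact: enorm_ge0.
  have -> : v t.+1 i w - g t i w
      = (v t i w - g t i w) + (v t.+1 i w - v t i w).
    by rewrite [RHS]addrC addrA subrK.
  by rewrite (enorm_distC (g t i w)); exact: ler_enormD.
rewrite ge0_expectationD; first last.
- exact/measurable_enorm/measurable_rVB.
- exact/measurable_enorm/measurable_rVB.
- by move=> w; exact: enorm_ge0.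
- by move=> w; exact: enorm_ge0.
apply: le_trans (leeD IH (increment_mean_le t i)) _.
by rewrite -EFinD lee_fin addrA.
Qed.

(** * Summed descent and the final rate *)

Let Delta0 := F x0 - inf (range F).

Let dF y : differentiable F y.
Proof. by apply: differentiable_raverage => i z; case: (df i). Qed.

Let grad_error t w := enorm (grad F (x t w) - average (fun i => g t i w)).

(* At [t = 0] the descent inequality would cost [2 * gamma0] times the error of
   [v0], which the last term of [V0] does not pay for when [alpha = 1]; there
   the gradient is bounded by the gap instead. *)
Lemma trajectory_sum_le T w :
  \sum_(t < T.+1) gamma t * enorm (grad F (x t w))
  <= 3 * Delta0 + 3 / 2 * L * gamma0 ^+ 2
     + \sum_(t < T) (2 * gamma t.+1 * grad_error t.+1 w
                     + L / 2 * gamma t.+1 ^+ 2).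
Proof.
suff : F (x T.+1 w) - inf (range F)
    + \sum_(t < T.+1) gamma t * enorm (grad F (x t w))
    <= 3 * Delta0 + 3 / 2 * L * gamma0 ^+ 2
     + \sum_(t < T) (2 * gamma t.+1 * grad_error t.+1 w
                     + L / 2 * gamma t.+1 ^+ 2).
  have : inf (range F) <= F (x T.+1 w) by apply: ge_inf => //; exists (x T.+1 w).
  lra.
elim: T => [|T IH].
  rewrite big_ord1 big_ord0 /=.
  (* The gradient term occurs twice, and each occurrence costs [Delta0 + L / 2 * gamma0 ^+ 2] by
     [h1]. Together with the initial gap and the curvature of the step this gives the constants 3
     and 3/2. *)
  have h0 := step_increase_le gamma_ge0 0 (state 0 w) (ltW L_gt0) dF F_lip.
  have h1 := gradient_le_gap (g := gamma0) x0 (ltW L_gt0) (ltW gamma0_gt0) dF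
    F_lip F_lb.
  have gE : gamma 0 = gamma0 by rewrite /gamma decay0 mulr1.
  move: h0; rewrite gE -[st_x (state 0 w)]/x0 => h0.
  rewrite -[x 0 w]/x0 -[x 1 w]/(ef21_step_x gamma 0 (state 0 w)) /Delta0.
  lra.
rewrite big_ord_recr [X in _ <= _ + X]big_ord_recr.
have h0 : F (x T.+2 w) + gamma T.+1 * enorm (grad F (x T.+1 w))
    <= F (x T.+1 w) + 2 * gamma T.+1 * grad_error T.+1 w
       + L / 2 * gamma T.+1 ^+ 2.
  exact: (normalized_descent gamma_ge0 T.+1 (state T.+1 w) (ltW L_gt0) dF F_lip).
exact: (telescope_step h0 IH).
Qed.

(** Only the noise [W] is averaged over clients before its norm is taken, which preserves the factor
    1 / sqrt n. The other two parts are bounded client by client. *)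
Lemma grad_error_le t w : grad_error t.+1 w <=
  raverage (fun i => enorm (g t.+1 i w - v t.+1 i w))
  + enorm (average (fun i => W t.+1 i w))
  + raverage Lhi * gamma0 ^+ 2 * eta t.+1.
Proof.
rewrite /grad_error grad_raverage; last by move=> i y; case: (df i).
have -> : average (fun i => grad (f i) (x t.+1 w)) - average (fun i => g t.+1 i w)
    = - (average (fun i => g t.+1 i w - v t.+1 i w)
       + average (fun i => W t.+1 i w)
       + average (fun i => e t.+1 i w - W t.+1 i w)).
  rewrite -!averageD -averageB /average -scalerN -sumrN; congr (_ *: _).
  apply: eq_bigr => i _; rewrite /e addrACA subrr addr0 addrA subrK.
  by rewrite opprB.
rewrite enormN; apply: le_trans (ler_enormD _ _) _; apply: lerD.
  apply: le_trans (ler_enormD _ _) _; apply: lerD => //.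
  exact: ler_enorm_average.
apply: le_trans (ler_enorm_average _) _.
rewrite -[leRHS]mulrA [leRHS]mulrC -raverageZ; apply: ler_raverage => i.
apply: le_trans (error_minus_noise_le _ _ _) _; rewrite mul0r add0r.
have -> : gamma0 ^+ 2 * eta t.+1 * Lhi i
  = Lhi i / 2 * gamma0 ^+ 2 * (2 * eta t.+1) by field.
have l0 := ltW (Lhi_gt0 i).
by rewrite ler_wpM2l ?decay_weight_le // mulr_ge0 ?divr_ge0 ?sqr_ge0.
Qed.

Lemma weighted_gradient_mean_le T :
  ('E_P[fun w => (\sum_(t < T.+1) gamma t * enorm (grad F (x t w)))%R]
  <= (3 * Delta0 + 3 / 2 * L * gamma0 ^+ 2
     + \sum_(t < T) (2 * gamma t.+1 *
         (raverage (fun i => compression_error_bound i t.+1)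
          + 2 * D_sigma * Num.sqrt (eta t.+1) / Num.sqrt n%:R
          + raverage Lhi * gamma0 ^+ 2 * eta t.+1)
         + L / 2 * gamma t.+1 ^+ 2))%:E)%E.
Proof.
have D0 : 0 <= Delta0 by rewrite subr_ge0; apply: ge_inf => //; exists x0.
have L0 := ltW L_gt0.
apply: (@le_trans _ _ ('E_P[fun w => (3 * Delta0 + 3 / 2 * L * gamma0 ^+ 2
     + \sum_(t < T) (2 * gamma t.+1 *
         (raverage (fun i => enorm (g t.+1 i w - v t.+1 i w))
          + enorm (average (fun i => W t.+1 i w))
          + raverage Lhi * gamma0 ^+ 2 * eta t.+1)
         + L / 2 * gamma t.+1 ^+ 2))%R])%E).
  apply: ge0_le_expectation => w.
    by apply: sumr_ge0 => t _; rewrite mulr_ge0 ?enorm_ge0.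
  apply: le_trans (trajectory_sum_le T w) _; rewrite lerD2l.
  apply: ler_sum => t _; rewrite lerD2r; apply: ler_wpM2l.
    exact: mulr_ge0.
  exact: grad_error_le.
suff [] : mean_le P (fun w => 3 * Delta0 + 3 / 2 * L * gamma0 ^+ 2
     + \sum_(t < T) (2 * gamma t.+1 *
         (raverage (fun i => enorm (g t.+1 i w - v t.+1 i w))
          + enorm (average (fun i => W t.+1 i w))
          + raverage Lhi * gamma0 ^+ 2 * eta t.+1)
         + L / 2 * gamma t.+1 ^+ 2))
   (3 * Delta0 + 3 / 2 * L * gamma0 ^+ 2
     + \sum_(t < T) (2 * gamma t.+1 *
         (raverage (fun i => compression_error_bound i t.+1)
          + 2 * D_sigma * Num.sqrt (eta t.+1) / Num.sqrt n%:R
          + raverage Lhi * gamma0 ^+ 2 * eta t.+1)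
         + L / 2 * gamma t.+1 ^+ 2)) by [].
apply: mean_leD.
  apply: mean_le_cst; apply: addr_ge0; first exact: mulr_ge0.
  by apply: mulr_ge0; [rewrite mulr_ge0 ?divr_ge0|exact: sqr_ge0].
apply: mean_le_sum => t; apply: mean_leD; last first.
  by apply: mean_le_cst; apply: mulr_ge0; [rewrite divr_ge0|exact: sqr_ge0].
apply: mean_leZ; first exact: mulr_ge0.
apply: mean_leD; last first.
  apply: mean_le_cst; apply: mulr_ge0; last exact: decay_ge0.
  apply: mulr_ge0; last exact: sqr_ge0.
  by apply: raverage_ge0 => i; exact: ltW.
apply: mean_leD.
  apply: mean_leZ; first by rewrite invr_ge0.
  apply: mean_le_sum => i; split; last exact: compression_error_le.
    exact/measurable_enorm/measurable_rVB.
  by move=> w; exact: enorm_ge0.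
split; last exact: average_noise_mean_le.
  exact/measurable_enorm/measurable_average.
by move=> w; exact: enorm_ge0.
Qed.

(** From sqrt(1 - alpha) <= 1 - alpha / 2 the denominator is at least alpha / 2; the power of alpha
    is then lowered using [alpha <= 1]. *)
Lemma compression_rate_le : r / (1 - r) <= 2 * (alpha ^+ 2)^-1.
Proof.
have /andP[a0 a1] := alpha01.
rewrite ler_pdivrMr ?subr_gt0 //.
have r2 : r <= 1 - alpha / 2.
  rewrite -(ler_pXn2r (n := 2)) ?nnegrE ?subr_ge0 //.
    by rewrite r_sqr -subr_ge0; have := sqr_ge0 alpha; rewrite !expr2; lra.
  by lra.
apply: (@le_trans _ _ (2 * (alpha ^+ 2)^-1 * (alpha / 2))); last first.
  rewrite ler_wpM2l ?mulr_ge0 ?invr_ge0 ?sqr_ge0 //; lra.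
have -> : 2 * (alpha ^+ 2)^-1 * (alpha / 2) = alpha^-1 by field; rewrite gt_eqF.
by apply: le_trans (ltW r_lt1) _; rewrite invf_ge1.
Qed.

Let sum_decay_bound (a : nat -> R) T :
  (forall t, a t <= 2 / t.+2%:R) ->
  \sum_(t < T.+1) a t <= 2 * ln T.+2%:R.
Proof.
move=> ab; apply: (@le_trans _ _ (2 * \sum_(t < T.+1) t.+2%:R^-1)).
  by rewrite mulr_sumr; apply: ler_sum.
by rewrite ler_wpM2l // sum_inv_le_ln.
Qed.

Let sum_decay_bound_shift (a : nat -> R) T : 0 <= a 0 ->
  (forall t, a t <= 2 / t.+2%:R) ->
  \sum_(t < T) a t.+1 <= 2 * ln T.+2%:R.
Proof.
move=> a0 ab; apply: le_trans (sum_decay_bound T ab).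
by rewrite big_ord_recl /= lerDr.
Qed.

Let Qavg : raverage Q
  = 4 * D_sigma + raverage Lhi * gamma0 ^+ 2 * (3 / 2) + raverage Li * gamma0.
Proof. by rewrite /Q !raverageD raverage_const // !raverageZr. Qed.

Lemma compression_error_sum_le T :
  \sum_(t < T) eta t.+1 * raverage (fun i => compression_error_bound i t.+1)
  <= r / (1 - r) * (raverage (fun i => enorm (g0 i - v0 i)) + raverage err0
     + 2 * ln T.+2%:R * raverage Q).
Proof.
have -> : \sum_(t < T) eta t.+1 * raverage (fun i => compression_error_bound i t.+1)
  = raverage (fun i => \sum_(t < T) eta t.+1 * compression_error_bound i t.+1).
  rewrite /raverage exchange_big mulr_sumr /=; apply: eq_bigr => t _.
  by rewrite -[in RHS]mulr_sumr mulrCA.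
rewrite -raverageZ -!raverageD -raverageZ; apply: ler_raverage => i.
have r01 : 0 <= r < 1 by rewrite r_ge0 r_lt1.
apply: le_trans (sum_decay_geometric T r01 (err0_ge0 i) (Q_ge0 i)
  (compression_error_bound_ge0 i) (fun t => erefl)) _.
rewrite ler_wpM2l ?divr_ge0 ?subr_ge0 ?(ltW r_lt1) // lerD2l mulrC ler_wpM2r //.
apply: le_trans (sum_decay_bound T (fun t => decay_sqr_le t)).
by rewrite big_ord_recr lerDl sqr_ge0.
Qed.

Let bound Lh := V0 alpha gamma0 f x0 g0 v0 / gamma0
  + D_sigma * ((Num.sqrt n%:R)^-1 + (alpha ^+ 2)^-1)
  + gamma0 * (L + raverage Li / alpha ^+ 2)
  + gamma0 ^+ 2 * (Lh + raverage Lhi / alpha ^+ 2).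

Lemma weighted_gradient_bound Lh T : 0 <= Lh ->
  ('E_P[fun w => (\sum_(t < T.+1) gamma t * enorm (grad F (x t w)))%R]
  <= (gamma0 * (32 * (1 + ln T.+2%:R) * bound Lh))%:E)%E.
Proof.
move=> Lh0; apply: le_trans (weighted_gradient_mean_le T) _; rewrite lee_fin.
have D0 : 0 <= Delta0 by rewrite subr_ge0; apply: ge_inf => //; exists x0.
have gg := ltW gamma0_gt0; have L0 := ltW L_gt0.
have l0 : 0 <= ln T.+2%:R :> R by rewrite ln_ge0 // ler1n.
have Lib : 0 <= raverage Li by apply: raverage_ge0 => i; exact: ltW.
have Lhb : 0 <= raverage Lhi by apply: raverage_ge0 => i; exact: ltW.
have a0 : 0 <= raverage (fun i => enorm (g0 i - v0 i)).
  by apply: raverage_ge0 => i; exact: enorm_ge0.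
have b0 : 0 <= raverage err0 by apply: raverage_ge0.
have s0 : 0 <= (Num.sqrt n%:R : R)^-1 by rewrite invr_ge0 sqrtr_ge0.
have /andP[al0 al1] := alpha01.
have q1 : 1 <= (alpha ^+ 2)^-1 by rewrite invf_ge1 ?exprn_gt0 // expr_le1 // ltW.
have rho0 : 0 <= r / (1 - r) by rewrite divr_ge0 ?subr_ge0 ?(ltW r_lt1).
have rho1 : r / (1 - r) <= (1 - r)^-1.
  by rewrite ler_piMl ?invr_ge0 ?subr_ge0 ?(ltW r_lt1).
have rho2 := compression_rate_le.
have sum1 : \sum_(t < T) eta t.+1 * Num.sqrt (eta t.+1) <= 2 * ln T.+2%:R.
  apply: (@sum_decay_bound_shift (fun t => eta t * Num.sqrt (eta t))) => [|t].
    by rewrite mulr_ge0 ?decay_ge0 ?sqrtr_ge0.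
  by rewrite /eta decay_mul_sqrt.
have sum2 : \sum_(t < T) eta t.+1 ^+ 2 <= 2 * ln T.+2%:R.
  apply: (@sum_decay_bound_shift (fun t => eta t ^+ 2)) => [|t].
    exact: sqr_ge0.
  exact: decay_sqr_le.
have sum3 := compression_error_sum_le T.
rewrite Qavg in sum3.
(* The terms are sorted by the power of eta they carry, so that [sum1], [sum2] and [sum3] apply one
   to each group. *)
have -> : \sum_(t < T) (2 * gamma t.+1 *
         (raverage (fun i => compression_error_bound i t.+1)
          + 2 * D_sigma * Num.sqrt (eta t.+1) / Num.sqrt n%:R
          + raverage Lhi * gamma0 ^+ 2 * eta t.+1)
         + L / 2 * gamma t.+1 ^+ 2)
  = 2 * gamma0 * (\sum_(t < T) eta t.+1 *
      raverage (fun i => compression_error_bound i t.+1))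
    + 4 * gamma0 * D_sigma * (Num.sqrt n%:R)^-1
      * (\sum_(t < T) eta t.+1 * Num.sqrt (eta t.+1))
    + (2 * gamma0 ^+ 3 * raverage Lhi + L / 2 * gamma0 ^+ 2)
      * \sum_(t < T) eta t.+1 ^+ 2.
  rewrite !mulr_sumr -!big_split /=; apply: eq_bigr => t _.
  rewrite /gamma -/(eta t.+1); generalize (eta t.+1) (Num.sqrt (eta t.+1))
    (raverage (fun i => compression_error_bound i t.+1)) (raverage Lhi)
    D_sigma (Num.sqrt n%:R : R)^-1 => *.
  by ring.
have -> : gamma0 * (32 * (1 + ln T.+2%:R) * bound Lh)
  = 32 * (1 + ln T.+2%:R) * (Delta0
     + 2 * gamma0 * (1 - r)^-1 * raverage (fun i => enorm (g0 i - v0 i))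
     + 2 * gamma0 * (r / (1 - r)) * raverage err0
     + gamma0 * (D_sigma * ((Num.sqrt n%:R)^-1 + (alpha ^+ 2)^-1))
     + gamma0 ^+ 2 * (L + raverage Li * (alpha ^+ 2)^-1)
     + gamma0 ^+ 3 * (Lh + raverage Lhi * (alpha ^+ 2)^-1)).
  rewrite mulrCA; congr (_ * _).
  have V0E : V0 alpha gamma0 f x0 g0 v0 = Delta0
    + 2 * gamma0 / (1 - r) * raverage (fun i => enorm (g0 i - v0 i))
    + 2 * gamma0 * r / (1 - r) * raverage err0 by [].
  have gn0 : gamma0 != 0 by rewrite gt_eqF.
  have rn0 : 1 - r != 0 by rewrite subr_eq0 gt_eqF.
  have sn0 : Num.sqrt n%:R != 0 :> R by rewrite gt_eqF // sqrtr_gt0 ltr0n.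
  rewrite /bound V0E; generalize Delta0 (raverage (fun i => enorm (g0 i - v0 i)))
    (raverage err0) D_sigma ((alpha ^+ 2)^-1) (raverage Li) (raverage Lhi) => *.
  by field; rewrite sn0 rn0 gn0.
apply: le_trans (final_arithmetic D0 a0 b0 D_sigma_ge0 s0 q1 rho0 rho1 rho2 l0 gg
  Lib Lhb L0 Lh0).
rewrite lerD2l; apply: lerD; first apply: lerD.
- by apply: ler_wpM2l; [exact: mulr_ge0|exact: sum3].
- apply: ler_wpM2l => //; apply: mulr_ge0 => //; apply: mulr_ge0 => //.
  exact: mulr_ge0.
- apply: ler_wpM2l => //; apply: addr_ge0; apply: mulr_ge0 => //.
  + by apply: mulr_ge0 => //; exact: exprn_ge0.
  + exact: divr_ge0.
  + exact: exprn_ge0.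
Qed.

Lemma output_gradient_mean_le Lh (T : nat) (tau : {RV P >-> nat}) :
  0 <= Lh -> (1 <= T)%N ->
  (forall t, (t < T)%N ->
     P (tau @^-1` [set t]) = (gamma t / \sum_(s < T) gamma s)%:E) ->
  independent P (sigma_of tau)
    <<s \bigcup_(t in [set t | (t < T)%N])
          sigma_of (fun w => x t w : borel_rV R d) >> ->
  ('E_P[fun w => enorm (grad F (x (tau w) w))]
     <= (32 * (1 + ln T.+1%:R) `^ 1 * (bound Lh / T%:R `^ (3^-1)))%:E)%E.
Proof.
move=> Lh0; case: T => // T _ tau_law tau_indep.
set S := \sum_(s < T.+1) gamma s in tau_law.
have TS : gamma0 * T.+1%:R `^ (3^-1) <= S.
  by rewrite /S /gamma -mulr_sumr ler_wpM2l ?(ltW gamma0_gt0) // sum_decay_ge.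
have T3 : 0 < T.+1%:R `^ (3^-1) :> R by rewrite powR_gt0.
have S0 : 0 < S by apply: lt_le_trans TS; rewrite mulr_gt0.
pose G := \bigcup_(t in [set t | (t < T.+1)%N])
          sigma_of (fun w => x t w : borel_rV R d).
(* The source space is arbitrary because the fact is needed both on [Omega] and on the sigma-algebra
   generated by the iterates. *)
have hmeas (dT : measure_display) (U : measurableType dT) (Y : U -> 'rV[R]_d) :
    measurable_rV Y -> measurable_fun setT (fun w => enorm (grad F (Y w))).
  move=> mY; apply: measurable_enorm.
  under eq_fun => w do [rewrite grad_raverage; last by move=> i z; case: (df i)].
  apply: measurable_average => i.
  apply: (@measurable_grad _ _ _ _ U U (fun=> f i) id) => //.
    by move=> _ y; case: (df i).
  by move=> y; exact: measurable_rV_cst.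
apply: (@le_trans _ _ ('E_P[fun w =>
    (\sum_(t < T.+1) gamma t / S * enorm (grad F (x t w)))%R])%E).
  apply: (expectation_random_index (G := G) _ tau_indep tau_law
    (h := fun t w => enorm (grad F (x t w)))).
  - move=> A [t _]; apply: sigma_of_measurable.
    by apply: measurable_fun_borel_rV; exact: mx.
  - by rewrite -mulr_suml divff // gt_eqF.
  - by move=> t w; exact: enorm_ge0.
  - by move=> t; apply: hmeas; exact: mx.
  - move=> t tT; apply: hmeas => j.
    have mxt : measurable_fun [set: g_sigma_algebraType G]
        (fun w => x t w : borel_rV R d).
      by apply/measurable_fun_generatedP => A HA; apply: sub_sigma_algebra; exists t.
    exact: (measurableT_comp (measurable_rV_borel j) mxt).
have -> : (fun w => \sum_(t < T.+1) gamma t / S * enorm (grad F (x t w)))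
    = (fun w => S^-1 * \sum_(t < T.+1) gamma t * enorm (grad F (x t w))).
  apply/funext => w; rewrite mulr_sumr; apply: eq_bigr => t _.
  by rewrite mulrA (mulrC S^-1).
rewrite ge0_expectationZ ?invr_ge0 ?(ltW S0) //; last 2 first.
- by move=> w; apply: sumr_ge0 => t _; rewrite mulr_ge0 ?enorm_ge0.
- apply: measurable_sum => t; apply: measurable_funM => //.
  by apply: hmeas; exact: mx.
(* The sign of the bound is read off from the nonnegative expectation below it, rather than term by
   term. *)
have B0 : 0 <= 32 * (1 + ln T.+2%:R) * bound Lh.
  have E0 : (0 <= 'E_P[fun w =>
      (\sum_(t < T.+1) gamma t * enorm (grad F (x t w)))%R])%E.
    apply: expectation_ge0 => w.
    by apply: sumr_ge0 => t _; rewrite mulr_ge0 ?enorm_ge0.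
  have := le_trans E0 (weighted_gradient_bound T Lh0).
  by rewrite lee_fin pmulr_rge0.
apply: le_trans (lee_wpmul2l _ (weighted_gradient_bound T Lh0)) _.
  by rewrite lee_fin invr_ge0 ltW.
rewrite -EFinM lee_fin powRr1; last by rewrite addr_ge0 // ln_ge0 // ler1n.
apply: (@le_trans _ _ ((S^-1 * gamma0) * (32 * (1 + ln T.+2%:R) * bound Lh))).
  by rewrite -[leRHS]mulrA.
apply: (@le_trans _ _ ((T.+1%:R `^ (3^-1))^-1 * (32 * (1 + ln T.+2%:R) * bound Lh))).
  by apply: ler_wpM2r => //; rewrite ler_pdivrMl // ler_pdivlMr.
by rewrite [leRHS]mulrA mulrC.
Qed.

End Algorithm.

Unset Implicit Arguments.

Theorem theorem4 (R : realType) :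
  exists C p : R, [/\ 0 < C, 0 <= p &
  forall (n d : nat)
    (* probability space, client sample spaces, compressor seed spaces *)
    (dO : measure_display) (Omega : measurableType dO)
    (P : probability Omega R)
    (dX : 'I_n -> measure_display) (X : forall i, measurableType (dX i))
    (D : forall i, probability (X i) R)
    (dZ : nat -> 'I_n -> measure_display)
    (Z : forall t i, measurableType (dZ t i))
    (xi : forall (t : nat) (i : 'I_n), {RV P >-> X i})
    (zeta : forall (t : nat) (i : 'I_n), {RV P >-> Z t i})
    (* objectives f_i, sampled objectives f_i(.; xi_i), compressors *)
    (f : 'I_n -> 'rV[R]_d -> R)
    (phi : forall i, X i -> 'rV[R]_d -> R)
    (c : forall (t : nat) (i : 'I_n), Z t i -> 'rV[R]_d -> 'rV[R]_d)
    (alpha L Lh sigma_g sigma_h gamma0 : R) (Li Lhi : 'I_n -> R)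
    (x0 : 'rV[R]_d) (g0 v0 : 'I_n -> 'rV[R]_d),
  let F := fun x => raverage (fun i => f i x) in
  let gamma := fun t => gamma0 * decay R t in
  let eta := fun t => decay R t in
  let state := fun t (w : Omega) =>
    ef21_hm gamma eta x0 g0 v0 (fun s i => phi i (xi s i w))
      (fun s i => c s i (zeta s i w)) t in
  let x := fun t w => st_x (state t w) in
  let compressor_input := fun t i (w : Omega) =>
    st_v (state t.+1 w) i - st_g (state t w) i : borel_rV R d in
  let D_sigma := sigma_g + gamma0 * sigma_h in
  let D1 := L + raverage Li / alpha ^+ 2 in
  let D2 := Lh + raverage Lhi / alpha ^+ 2 in
  (0 < n)%N ->
  0 < gamma0 ->
  (* f_i and f_i(.; xi_i) *)
  (forall i, twice_differentiable (f i)) ->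
  (forall i s, twice_differentiable (phi i s)) ->
  (forall i y, has_mean (D i) (fun s => phi i s y) (f i y)) ->
  (* samples *)
  (forall t i A, measurable A -> distribution P (xi t.+1 i) A = D i A) ->
  (forall t, mutually_independent P (fun o : option 'I_n =>
     if o is Some i then sigma_of (xi t.+1 i) else history xi zeta t)) ->
  (* freshness of the compressor randomness *)
  (forall t i, random_map_measurable (c t.+1 i)) ->
  (forall t i, independent P (sigma_of (zeta t.+1 i))
     <<s history xi zeta t `|` sigma_of (compressor_input t i) >>) ->
  (* (i) *)
  0 < alpha <= 1 ->
  (forall t i, contractive P alpha (fun w => c t.+1 i (zeta t.+1 i w))) ->
  (* (ii) *)
  has_lbound (range F) ->
  (* (iii) *)
  (forall i, 0 < Li i) -> (forall i, lipschitz_grad (Li i) (f i)) ->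
  (* (iv) *)
  0 < L -> lipschitz_grad L F ->
  (* (v) *)
  (forall i, 0 < Lhi i) -> (forall i, lipschitz_hess (Lhi i) (f i)) ->
  0 < Lh -> lipschitz_hess Lh F ->
  (* (vi) *)
  0 <= sigma_g -> 0 <= sigma_h ->
  (forall i y, has_mean_mx (D i) (fun s => grad (phi i s) y) (grad (f i) y)) ->
  (forall i y, ('E_(D i)[fun s => (enorm (grad (phi i s) y - grad (f i) y) ^+ 2)%R]
     <= (sigma_g ^+ 2)%:E)%E) ->
  (forall i y, has_mean_mx (D i) (fun s => hess (phi i s) y) (hess (f i) y)) ->
  (forall i y,
     ('E_(D i)[fun s => (spectral_norm (hess (phi i s) y - hess (f i) y) ^+ 2)%R]
     <= (sigma_h ^+ 2)%:E)%E) ->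
  forall (T : nat) (tau : {RV P >-> nat}),
  (1 <= T)%N ->
  (* tau is the random index of the output, drawn independently of the
     iterates x^0, ..., x^{T-1} *)
  (forall t, (t < T)%N ->
     P (tau @^-1` [set t]) = (gamma t / \sum_(s < T) gamma s)%:E) ->
  independent P (sigma_of tau)
    <<s \bigcup_(t in [set t | (t < T)%N])
          sigma_of (fun w => x t w : borel_rV R d) >> ->
  ('E_P[fun w => enorm (grad F (x (tau w) w))]
     <= (C * (1 + ln T.+1%:R) `^ p
         * ((V0 alpha gamma0 f x0 g0 v0 / gamma0
             + D_sigma * ((Num.sqrt n%:R)^-1 + (alpha ^+ 2)^-1)
             + gamma0 * D1 + gamma0 ^+ 2 * D2) / T%:R `^ (3^-1)))%:E)%E].
Proof.
(* 32 is the constant of [final_arithmetic]; the single logarithm comes from sums of 1/(t+2). *)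
exists 32, 1; split => //.
move=> n d dO Omega P dX X D dZ Z xi zeta f phi c alpha L Lh sigma_g sigma_h.
move=> gamma0 Li Lhi x0 g0 v0 /= n0 gamma00 df dphi _ xi_law xi_indep c_meas.
move=> zeta_indep alpha01 c_contr F_lb Li0 f_lip L0 F_lip Lhi0 f_hlip Lh0 _.
move=> sigma_g0 sigma_h0 mean_grad var_grad mean_hess var_hess T tau T1 tau_law.
move=> tau_indep.
exact: (output_gradient_mean_le n0 gamma00 df dphi xi_law xi_indep c_meas
  zeta_indep alpha01 c_contr F_lb Li0 f_lip L0 F_lip Lhi0 f_hlip sigma_g0
  sigma_h0 mean_grad var_grad mean_hess var_hess (ltW Lh0) T1 tau_law tau_indep).
Qed.
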